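(* Let $t>0$, and let $f:\mathbb{R}^n\to\mathbb{R}$ be $C^2$ and concave. Assume there exist $c_1\ge0$ and $0\le c_2<\frac{1}{2t}$ such that $|f(x)|\le c_1e^{c_2|x|^2}$ for all $x\in\mathbb{R}^n$. Then there is a unique $y^*\in\mathbb{R}^n$ satisfying $$y^*=t\int_{\mathbb{R}^n}\nabla f\,d\gamma_{y^*,t},$$ and it holds that $$\log\int_{\mathbb{R}^n}e^f\,d\gamma_t\le\sup_{y\in\mathbb{R}^n}\left(\int_{\mathbb{R}^n}f\,d\gamma_{y,t}-H(\gamma_{y,t}\,|\,\gamma_t)\right)+\frac{t^2}{2}\sum_{i,j=1}^n\int_{\mathbb{R}^n}|\partial_{ij}f|^2\,d\gamma_{y^*,t}.$$
   Context: For $y\in\mathbb{R}^n$ and $t>0$, $\gamma_{y,t}$ denotes the Gaussian measure on $\mathbb{R}^n$ with mean $y$ and covariance matrix $tI$, and $\gamma_t:=\gamma_{0,t}$. $H(Q\,|\,Q')=\int\frac{dQ}{dQ'}\log\frac{dQ}{dQ'}\,dQ'$ if $Q\ll Q'$ and $=\infty$ otherwise (relative entropy). *)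

(* Defs.v *)
From HB Require Import structures.
From mathcomp Require Import all_boot all_order all_algebra.
From mathcomp Require Import all_classical all_reals all_analysis.

Set Implicit Arguments.
Unset Strict Implicit.
Unset Printing Implicit Defensive.

Import Order.TTheory GRing.Theory Num.Theory.
Import numFieldNormedType.Exports.

Local Open Scope classical_set_scope.
Local Open Scope ring_scope.

(* The library has no sigma-algebra on row vectors. We use the product
   sigma-algebra, as it does for n.-tuple T; for T = R this is the Borel
   sigma-algebra of R^n. *)
Definition measure_rV_display : measure_display -> measure_display.
Proof. exact. Qed.

Section measurable_rV.
Context {d} {T : sigmaRingType d}.
Variable n : nat.

Let coors : 'I_n -> 'rV[T]_n -> T := fun i x => x ord0 i.

Let rV_set0 : g_sigma_preimage coors set0.
Proof. exact: sigma_algebra0. Qed.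

Let rV_setC A : g_sigma_preimage coors A -> g_sigma_preimage coors (~` A).
Proof. exact: sigma_algebraC. Qed.

Let rV_bigcup (F : _^nat) : (forall i, g_sigma_preimage coors (F i)) ->
  g_sigma_preimage coors (\bigcup_i (F i)).
Proof. exact: sigma_algebra_bigcup. Qed.

HB.instance Definition _ := @isMeasurable.Build (measure_rV_display d)
  'rV[T]_n (g_sigma_preimage coors) rV_set0 rV_setC rV_bigcup.

End measurable_rV.

Lemma measurable_coord d (T : sigmaRingType d) n (i : 'I_n) :
  measurable_fun [set: 'rV[T]_n] (fun x : 'rV[T]_n => x ord0 i).
Proof.
move=> _ Y mY; rewrite setTI; apply: sub_sigma_algebra => /=.
rewrite -bigcup_seq/=; exists i => /=; first by rewrite mem_index_enum.
by exists Y => //; rewrite setTI.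
Qed.

Lemma measurable_fun_rV d1 d2 (T1 : measurableType d1)
    (T2 : measurableType d2) n (f : T1 -> 'rV[T2]_n) :
  (forall i, measurable_fun [set: T1] (fun x => f x ord0 i)) ->
  measurable_fun [set: T1] f.
Proof.
move=> mf.
have sub : g_sigma_preimage (fun i x => f x ord0 i) `<=` @measurable _ T1.
  apply: smallest_sub; first exact: sigma_algebra_measurable.
  rewrite -bigcup_seq; apply: bigcup_sub => i _ A [B mB <-].
  exact: mf.
move=> _ A mA; apply: sub.
rewrite (g_sigma_preimage_comp (fun i (v : 'rV[T2]_n) => v ord0 i) f).
by exists A.
Qed.

(* measurableTypeR R is the copy of R on which normal_prob is a measure. *)
Definition row_cons (R : realType) n (p : measurableTypeR R * 'rV[R]_n) :
    'rV[R]_n.+1 :=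
  \row_i (if unlift ord0 i is Some j then p.2 ord0 j else p.1).

Section row_cons_mfun.
Context (R : realType) (n : nat).

Let measurable_row_cons :
  measurable_fun [set: measurableTypeR R * 'rV[R]_n] (@row_cons R n).
Proof.
apply: measurable_fun_rV => i.
case: (unliftP ord0 i) => [j|] ->.
- under eq_fun do rewrite mxE liftK.
  exact: (measurableT_comp (measurable_coord j) measurable_snd).
- under eq_fun do rewrite mxE unlift_none.
  exact: measurable_fst.
Qed.

HB.instance Definition _ := isMeasurableFun.Build _ _ _ _ (@row_cons R n)
  measurable_row_cons.

End row_cons_mfun.

(* N(y_0, t) x ... x N(y_(n-1), t); normal_prob is parameterized by the
   standard deviation. Only meaningful for t > 0. *)
Fixpoint gaussian (R : realType) (n : nat) :
    'rV[R]_n -> R -> probability 'rV[R]_n R :=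
  match n return 'rV[R]_n -> R -> probability 'rV[R]_n R with
  | 0 => fun y _ => dirac y
  | m.+1 => fun y t =>
      distribution
        (normal_prob (y ord0 ord0) (Num.sqrt t) \x
         gaussian (\row_(i < m) y ord0 (lift ord0 i)) t)%E
        (@row_cons R m)
  end.

Local Open Scope charge_scope.

(* At points where the density vanishes, 0 * lne 0 = 0 * -oo = 0. *)
Definition relative_entropy d (T : measurableType d) (R : realType)
    (Q Q' : probability T R) : \bar R :=
  if `[< Q `<< Q' >] then
    (\int[Q']_x (('d (charge_of_finite_measure Q) '/d Q') x *
                 lne (('d (charge_of_finite_measure Q) '/d Q') x)))%E
  else +oo%E.

(* The norm of 'rV[R]_n in the library is the sup norm. *)
Definition sqnorm2 (R : realType) n (x : 'rV[R]_n) : R :=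
  \sum_(i < n) x ord0 i ^+ 2.

Definition partial (R : realType) n (i : 'I_n) (f : 'rV[R]_n -> R) :
    'rV[R]_n -> R :=
  'D_(delta_mx ord0 i) f.

Fixpoint Ck (R : realType) n (k : nat) (f : 'rV[R]_n -> R) : Prop :=
  match k with
  | 0 => continuous f
  | k'.+1 => continuous f /\
      forall i : 'I_n, (forall x, derivable f x (delta_mx ord0 i)) /\
                       Ck k' (partial i f)
  end.

Definition concave_function (R : realType) n (f : 'rV[R]_n -> R) : Prop :=
  convex_function [set: convex_lmodType 'rV[R]_n] (fun x => - f x).

(* Main.v *)
(* Let l be the logarithm of the density of gamma_y with respect to gamma_0, an
   affine function. The gamma_0-integral of e^f is the gamma_y-integral of e^g,
   where g = f - l is concave. By concavity, the supremum over z of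
   g z - |x - z|^2 / (2 t) is at most g x + (t / 2) |grad g x|^2, so the dual form
   of Talagrand's transport inequality (a change of variables along the monotone
   map in dimension one, then induction on the dimension) bounds the logarithm
   of the integral of e^g by the gamma_y-integral of g + (t / 2) |grad g|^2.
   The integral of g is that of f minus the relative entropy. At y = y*, the
   derivatives of g have mean zero, so the Poincare inequality bounds the
   integrals of their squares by t times those of the second derivatives.
   The point y* is the unique maximizer of the strictly concave function that
   takes y to the gamma_y-integral of f minus |y|^2 / (2 t). *)
Require Import Defs.
From HB Require Import structures.
From mathcomp Require Import all_boot all_order all_algebra.
From mathcomp Require Import all_classical all_reals all_analysis.
From mathcomp Require Import measurable_realfun.
From mathcomp Require Import ring lra.

Set Implicit Arguments.
Unset Strict Implicit.
Unset Printing Implicit Defensive.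

Import Order.TTheory GRing.Theory Num.Theory.
Import numFieldNormedType.Exports.

Local Open Scope classical_set_scope.
Local Open Scope ring_scope.

(** The transport inequality is proved for a pair ([g], [h]) tied by a pointwise cost inequality
    instead of for [g] and its sup-convolution. Such pairs pass to fibre integrals in the induction
    on the dimension, no supremum has to be shown measurable, and [g + (t / 2) |grad g|^2] can be
    inserted for [h] directly. On the line everything is first done on segments centred at the mean.
    There the transport map fixes both end points, and the normal density takes the same value at
    both, so boundary terms vanish or have a sign; the length then tends to infinity. The Poincare
    inequality bounds the double integral of [(f x - f x')^2], twice the variance, in the extended
    reals. This form makes sense without square integrability and tensorizes by a four-point
    inequality. The hypotheses bound the growth of [f] only. Concavity carries the bound over to the
    first derivatives, but the integrals of the squared second derivatives may be infinite, a case
    treated apart at the end. *)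

Section ge0_density.
Local Open Scope ereal_scope.
Context d (T : measurableType d) (R : realType).
Variables (mu nu : {measure set T -> \bar R}) (p : T -> R).
Hypotheses (mp : measurable_fun setT p) (p0 : forall x, (0 <= p x)%R).
Hypothesis nuE : forall A, measurable A -> nu A = \int[mu]_(x in A) (p x)%:E.

Import HBNNSimple.

(** Monotone approximation by simple functions reduces the claim to indicators, where it is [nuE].
    The density is a given function [p], so the formula holds with no choice of an almost-everywhere
    representative. *)
Lemma ge0_integral_density (f : T -> \bar R) :
  measurable_fun setT f -> (forall x, 0 <= f x) ->
  \int[nu]_x f x = \int[mu]_x (f x * (p x)%:E).
Proof.
move=> mf f0.
pose f_ := nnsfun_approx measurableT mf.
have f_cvg x : (f_ n x)%:E @[n --> \oo] --> f x by exact: cvg_nnsfun_approx.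
have f_nd x m n : (m <= n)%N -> (f_ m x)%:E <= (f_ n x)%:E.
  by move=> mn; rewrite lee_fin; exact/lefP/nd_nnsfun_approx.
have mf_ n : measurable_fun setT (EFin \o f_ n).
  exact/measurable_EFinP/measurable_funP.
transitivity (limn (fun n => \int[nu]_x (f_ n x)%:E)).
  rewrite -monotone_convergence//.
  - by apply: eq_integral => x _; apply/esym/cvg_lim.
  - by move=> n x _; rewrite lee_fin.
  - by move=> x _ m n; exact: f_nd.
transitivity (limn (fun n => \int[mu]_x ((f_ n x)%:E * (p x)%:E))); last first.
  rewrite -monotone_convergence//; last 3 first.
  - by move=> n; apply: emeasurable_funM => //; exact/measurable_EFinP.
  - by move=> n x _; rewrite mule_ge0// lee_fin.
  - by move=> x _ m n mn; apply: lee_wpmul2r; [by rewrite lee_fin|exact: f_nd].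
  apply: eq_integral => x _; apply/cvg_lim => //.
  by apply: cvgeZr => //; exact: f_cvg.
congr (limn _); apply/funext => n.
transitivity (\sum_(k \in range (f_ n))
    \int[nu]_x (k * \1_(f_ n @^-1` [set k]) x)%:E).
  under eq_integral do rewrite fimfunE -fsumEFin//.
  rewrite ge0_integral_fsum//.
  - by move=> r; exact/measurable_EFinP/measurable_funM.
  - by move=> r x _; rewrite nnfun_muleindic_ge0.
transitivity (\sum_(k \in range (f_ n))
    \int[mu]_x ((k * \1_(f_ n @^-1` [set k]) x)%:E * (p x)%:E)); last first.
  rewrite -ge0_integral_fsum//.
  - apply: eq_integral => x _; rewrite [in RHS]fimfunE -fsumEFin//.
    rewrite -!ge0_mule_fsuml// => r; exact: nnfun_muleindic_ge0.
  - move=> r; apply: emeasurable_funM; last exact/measurable_EFinP.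
    exact/measurable_EFinP/measurable_funM.
  - by move=> r x _; apply: mule_ge0; [exact: nnfun_muleindic_ge0|rewrite lee_fin].
apply: eq_fsbigr => r /[!inE] -[x _ <-].
have m1 : measurable (f_ n @^-1` [set f_ n x]) by [].
under eq_integral do rewrite EFinM.
under [RHS]eq_integral do rewrite EFinM -muleA.
rewrite !ge0_integralZl//.
- rewrite integral_indic// setIT; congr (_ * _).
  rewrite nuE// [LHS]integral_mkcond; apply: eq_integral => y _.
  by rewrite epatch_indic muleC.
- by apply: emeasurable_funM => //; exact/measurable_EFinP.
- by move=> y _; rewrite mule_ge0// lee_fin.
- by rewrite lee_fin.
- exact/measurable_EFinP.
- by rewrite lee_fin.
Qed.

End ge0_density.

(** The sigma-algebra is generated by the coordinates, so an open set has to be a countable union of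
    boxes: those with rational centre and half-width [1 / (k + 1)] that it contains. *)
Lemma open_measurable_rV (R : realType) n (O : set 'rV[R]_n) :
  open O -> measurable O.
Proof.
move=> oO.
pose B (p : 'rV[rat]_n * nat) : set 'rV[R]_n :=
  [set x | forall i, `|x ord0 i - ratr (p.1 ord0 i)| < p.2.+1%:R^-1].
pose F p := if `[< B p `<=` O >] then B p else set0.
have -> : O = \bigcup_p F p.
  apply/seteqP; split => [x Ox|x [p _]]; rewrite /F; last first.
    by case: asboolP => // BO Bx; exact: BO.
  have /nbhs_ballP[e /= e0 xe] : nbhs x O by exact: open_nbhs_nbhs.
  (* A box of half-width below [e / 2] that contains [x] lies in the [e]-ball of the sup norm around
     [x]. *)
  have [k ke] : exists k : nat, k.+1%:R^-1 < e / 2.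
    have := near_infty_natSinv_lt (PosNum (divr_gt0 e0 (@ltr0n R 2))).
    by case=> N _ NP; exists N; exact: NP (leqnn N).
  have hq (d : R) : 0 < d -> forall i, exists q : rat, `|x ord0 i - ratr q| < d.
    move=> d0 i; have : x ord0 i - d < x ord0 i + d by lra.
    move=> /rat_in_itvoo[q]; rewrite in_itv/= => /andP[? ?]; exists q.
    by rewrite ltr_norml; apply/andP; split; lra.
  have [q qx] := choice (hq k.+1%:R^-1 ltac:(by rewrite invr_gt0)).
  exists (\row_i q i, k) => //; case: asboolP => [_ i|].
    by rewrite mxE.
  case=> z Bz; apply: xe; split=> // i j; rewrite ord1 /ball /=.
  have := Bz j; rewrite /= mxE => zq; have := qx j; move: zq ke.
  move: (k.+1%:R^-1) => d + de.
  rewrite !ltr_norml => /andP[? ?] /andP[? ?]; apply/andP; split; lra.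
apply: countable_bigcupT_measurable => [|p]; first exact: countableP.
rewrite /F; case: asboolP => _; last exact: measurable0.
rewrite [B p](_ : _ = \bigcap_(i in [set: 'I_n])
  ((fun x : 'rV[R]_n => x ord0 i) @^-1` `]ratr (p.1 ord0 i) - p.2.+1%:R^-1,
    ratr (p.1 ord0 i) + p.2.+1%:R^-1[)); last first.
  apply/seteqP; split => [x Bx i _|x Bx i] /=.
    by rewrite in_itv/=; have := Bx i; rewrite ltr_distl.
  by rewrite ltr_distl; have := Bx i I; rewrite /= in_itv.
apply: fin_bigcap_measurable => // i _.
by rewrite -[X in measurable X]setTI; apply: measurable_coord.
Qed.

Lemma continuous_measurable_rV (R : realType) n (f : 'rV[R]_n -> R) :
  continuous f -> measurable_fun [set: 'rV[R]_n] f.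
Proof.
move=> /continuousP cf; apply: (measurability _ (RGenOpens.measurableE R)).
move=> _ [_ [a [b ->] <-]]; rewrite setTI; apply: open_measurable_rV.
exact/cf/interval_open.
Qed.

(** * Gaussian integrals *)

Section gaussian_integral.
Context (R : realType).
Local Open Scope ereal_scope.

Lemma ge0_integral_normal (m s : R) (f : R -> \bar R) :
  measurable_fun setT f -> (forall x, 0 <= f x) ->
  \int[normal_prob m s]_x f x =
  \int[lebesgue_measure]_x (f x * (normal_pdf m s x)%:E).
Proof.
move=> mf f0; apply: ge0_integral_density => //.
  exact: measurable_normal_pdf.
by move=> x; exact: normal_pdf_ge0.
Qed.

Definition rV_behead n (y : 'rV[R]_n.+1) : 'rV[R]_n :=
  \row_(i < n) y ord0 (lift ord0 i).

Lemma measurable_row_cons n :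
  measurable_fun [set: measurableTypeR R * 'rV[R]_n] (@row_cons R n).
Proof. exact: measurable_funP. Qed.

Section gaussianS.
Variables (n : nat) (y : 'rV[R]_n.+1) (t : R) (f : 'rV[R]_n.+1 -> \bar R).
Let P := normal_prob (y ord0 ord0) (Num.sqrt t).
Let Q := gaussian (rV_behead y) t.

Lemma ge0_integral_gaussianS : measurable_fun setT f -> (forall x, 0 <= f x) ->
  \int[gaussian y t]_x f x = \int[P]_a \int[Q]_b f (row_cons (a, b)).
Proof.
move=> mf f0; rewrite /= ge0_integral_pushforward//.
rewrite preimage_setT fubini_tonelli1//.
  by apply: measurableT_comp => //; exact: measurable_row_cons.
by move=> x /=.
Qed.

Lemma integrable_gaussianS :
  (gaussian y t).-integrable setT f ->
  (P \x Q).-integrable setT (f \o @row_cons R n).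
Proof.
move=> /integrableP[mf fi]; apply/integrableP; split.
  by apply: measurableT_comp => //; exact: measurable_row_cons.
move: fi; rewrite /= ge0_integral_pushforward//.
exact: measurableT_comp.
Qed.

Lemma integral_gaussianS : (gaussian y t).-integrable setT f ->
  \int[gaussian y t]_x f x = \int[P]_a \int[Q]_b f (row_cons (a, b)).
Proof.
move=> fi; have mf := measurable_int _ fi.
rewrite /= integral_pushforward//; last exact: integrable_gaussianS.
by rewrite -(integral12_prod_meas1 (integrable_gaussianS fi)).
Qed.

End gaussianS.

End gaussian_integral.

(** * Translations and changes of the mean *)

Section gaussian_shift.
Context (R : realType).
Implicit Types (t m : R).

Definition dotrV n (x y : 'rV[R]_n) : R := \sum_(i < n) x ord0 i * y ord0 i.

Lemma measurable_shift_rV n (y : 'rV[R]_n) :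
  measurable_fun [set: 'rV[R]_n] (fun x => x + y).
Proof.
apply: measurable_fun_rV => i; under eq_fun do rewrite mxE.
by apply: measurable_funD => //; exact: measurable_coord.
Qed.

Lemma row_cons0 n a (b : 'rV[R]_n) : row_cons (a, b) ord0 ord0 = a.
Proof. by rewrite mxE unlift_none. Qed.

Lemma row_consS n a (b : 'rV[R]_n) i :
  row_cons (a, b) ord0 (lift ord0 i) = b ord0 i.
Proof. by rewrite mxE liftK. Qed.

Lemma row_consDE n a (b : 'rV[R]_n) y :
  row_cons (a, b) + y = row_cons (a + y ord0 ord0, b + rV_behead y).
Proof.
apply/rowP => i; rewrite mxE.
by case: (unliftP ord0 i) => [j|] ->; rewrite ?row_cons0 ?row_consS ?mxE.
Qed.

Lemma row_consK n (y : 'rV[R]_n.+1) : row_cons (y ord0 ord0, rV_behead y) = y.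
Proof.
apply/rowP => i.
by case: (unliftP ord0 i) => [j|] ->; rewrite ?row_cons0 ?row_consS ?mxE.
Qed.

Lemma rV_behead0 n : rV_behead 0 = 0 :> 'rV[R]_n.
Proof. by apply/rowP => i; rewrite !mxE. Qed.

Lemma normal_pdf_sqrt t m x : 0 < t ->
  normal_pdf m (Num.sqrt t) x =
  normal_peak (Num.sqrt t) * expR (- (x - m) ^+ 2 / (2 * t)).
Proof.
move=> t0; rewrite normal_pdfE ?gt_eqF ?sqrtr_gt0// /normal_fun.
by rewrite sqr_sqrtr ?ltW// mulr_natl.
Qed.

(** Lebesgue measure is determined by its values on half-open intervals, whose length translation
    preserves. *)
Lemma lebesgue_measure_shift (c : R) (A : set R) : measurable A ->
  pushforward lebesgue_measure ((fun x => x + c) : _ -> measurableTypeR R) A =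
  lebesgue_measure A.
Proof.
move=> mA.
have mc : measurable_fun [set: R] (fun x : R => x + c) by exact: measurable_funD.
apply/esym/lebesgue_measure_unique => //= _ [[a b]] _ <-.
rewrite /pushforward [X in _ = lebesgue_measure X](_ : _ = `]a - c, b - c]%classic).
  by rewrite !lebesgue_measure_itv/= !lte_fin ltrD2r -!EFinB opprB addrA subrK.
by apply/seteqP; split => x /=; rewrite !in_itv/= ltrBlDr lerBrDr.
Qed.

Local Open Scope ereal_scope.

Lemma ge0_integral_normal_shift m t (f : R -> \bar R) : (0 < t)%R ->
  measurable_fun setT f -> (forall x, 0 <= f x) ->
  \int[normal_prob m (Num.sqrt t)]_x f x =
  \int[normal_prob 0 (Num.sqrt t)]_x f (x + m)%R.
Proof.
move=> t0 mf f0.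
have mc : measurable_fun [set: R] (fun x : R => x + m)%R.
  exact: measurable_funD.
have mp : measurable_fun [set: R] (EFin \o normal_pdf m (Num.sqrt t)).
  by apply/measurable_EFinP; exact: measurable_normal_pdf.
have -> := ge0_integral_normal m (Num.sqrt t) mf f0.
have -> := ge0_integral_normal 0 (Num.sqrt t) (measurableT_comp mf mc)
  (fun x => f0 (x + m)%R).
transitivity (\int[pushforward lebesgue_measure
    ((fun x => x + m)%R : _ -> measurableTypeR R)]_x
    (f x * (normal_pdf m (Num.sqrt t) x)%:E)).
  by apply: eq_measure_integral => A mA _; exact/esym/lebesgue_measure_shift.
rewrite ge0_integral_pushforward; last 4 first.
- exact: mc.
- exact: measurableT.
- exact: emeasurable_funM mf mp.
- by move=> x _; apply: mule_ge0; [exact: f0|rewrite lee_fin normal_pdf_ge0].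
rewrite preimage_setT; apply: eq_integral => x _ /=.
by rewrite !normal_pdf_sqrt// subr0 addrK.
Qed.

Lemma measurable_integral_row_cons n (Q : probability 'rV[R]_n R)
    (f : 'rV[R]_n.+1 -> \bar R) :
  measurable_fun setT f -> (forall x, 0 <= f x) ->
  measurable_fun [set: R] (fun a => \int[Q]_b f (row_cons (a, b))).
Proof.
move=> mf f0.
apply: (measurable_fun_fubini_tonelli_F (m2 := Q) (f \o @row_cons R n)).
  by apply: measurableT_comp => //; exact: measurable_row_cons.
by move=> x /=.
Qed.

Lemma measurable_row_cons2 n (a : R) :
  measurable_fun [set: 'rV[R]_n] (fun b => row_cons (a, b)).
Proof.
apply: measurableT_comp; first exact: measurable_row_cons.
exact: pair1_measurable.
Qed.

(** Moves the dependence on the mean from the measure into the integrand, where dominated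
    convergence can act on it. *)
Lemma ge0_integral_gaussian_shift n (y : 'rV[R]_n) t (f : 'rV[R]_n -> \bar R) :
  (0 < t)%R -> measurable_fun setT f -> (forall x, 0 <= f x) ->
  \int[gaussian y t]_x f x = \int[gaussian 0 t]_x f (x + y)%R.
Proof.
move=> t0; elim: n y f => [|n IH] y f mf f0.
  rewrite /= !integral_dirac// ?diracT ?mul1e ?add0r//.
  by apply: measurableT_comp => //; exact: measurable_shift_rV.
have mfy : measurable_fun setT (fun x : 'rV[R]_n.+1 => f (x + y)%R).
  by apply: measurableT_comp => //; exact: measurable_shift_rV.
apply: etrans (ge0_integral_gaussianS y t mf f0) _.
apply: etrans _ (esym (ge0_integral_gaussianS 0 t mfy (fun x => f0 (x + y)%R))).
rewrite rV_behead0 mxE.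
rewrite ge0_integral_normal_shift; [|exact: t0| |]; first last.
- by move=> a; apply: integral_ge0 => b _; exact: f0.
- exact: measurable_integral_row_cons.
- apply: eq_integral => a _; rewrite IH//; last first.
    by apply: measurableT_comp => //; exact: measurable_row_cons2.
  by apply: eq_integral => b _; rewrite row_consDE.
Qed.

Lemma gaussian_shiftE n (y : 'rV[R]_n) t (A : set 'rV[R]_n) : (0 < t)%R ->
  measurable A ->
  gaussian y t A = pushforward (gaussian 0 t) (fun x => x + y)%R A.
Proof.
move=> t0 mA.
have mAy : measurable ((fun x => x + y)%R @^-1` A).
  by rewrite -[X in measurable X]setTI; exact: measurable_shift_rV.
have E (P : probability 'rV[R]_n R) B : measurable B ->
    \int[P]_x (\1_B x)%:E = P B.
  by move=> mB; rewrite integral_indic// setIT.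
rewrite /pushforward -!E// ge0_integral_gaussian_shift//.
by apply/measurable_EFinP.
Qed.

Lemma integrable_gaussian_shift n (y : 'rV[R]_n) t (f : 'rV[R]_n -> \bar R) :
  (0 < t)%R -> measurable_fun setT f ->
  (gaussian y t).-integrable setT f <->
  (gaussian 0 t).-integrable setT (fun x => f (x + y)%R).
Proof.
move=> t0 mf; split => /integrableP[_ fi]; apply/integrableP; split => //.
- by apply: measurableT_comp => //; exact: measurable_shift_rV.
- move: fi; rewrite ge0_integral_gaussian_shift//.
  exact: measurableT_comp.
- rewrite ge0_integral_gaussian_shift//.
  exact: measurableT_comp.
Qed.

Lemma integral_gaussian_shift n (y : 'rV[R]_n) t (f : 'rV[R]_n -> \bar R) :
  (0 < t)%R -> (gaussian y t).-integrable setT f ->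
  \int[gaussian y t]_x f x = \int[gaussian 0 t]_x f (x + y)%R.
Proof.
move=> t0 fi; have mf := measurable_int _ fi.
have ms := measurable_shift_rV y.
transitivity (\int[pushforward (gaussian 0 t) (fun x => x + y)%R]_x f x).
  apply: eq_measure_integral => A mA _.
  exact: (gaussian_shiftE y t0 mA).
rewrite integral_pushforward//.
by rewrite preimage_setT; apply: (integrable_gaussian_shift y t0 mf).1.
Qed.

End gaussian_shift.

Section gaussian_density.
Context (R : realType).
Implicit Types (t m : R).
Local Open Scope ereal_scope.

Lemma ge0_integral_normal_density m t (f : R -> \bar R) : (0 < t)%R ->
  measurable_fun setT f -> (forall x, 0 <= f x) ->
  \int[normal_prob m (Num.sqrt t)]_x f x =
  \int[normal_prob 0 (Num.sqrt t)]_x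
    (f x * (expR (x * m / t - m ^+ 2 / (2 * t)))%:E).
Proof.
move=> t0 mf f0.
pose r x := expR (x * m / t - m ^+ 2 / (2 * t)).
have mr : measurable_fun [set: R] (EFin \o r).
  apply/measurable_EFinP; apply: measurableT_comp => //.
  by apply: measurable_funB => //; do 2 apply: measurable_funM => //.
have mfr : measurable_fun [set: R] (fun x => f x * (r x)%:E).
  exact: emeasurable_funM mf mr.
have fr0 x : 0 <= f x * (r x)%:E.
  by apply: mule_ge0; [exact: f0|rewrite lee_fin expR_ge0].
have -> := ge0_integral_normal m (Num.sqrt t) mf f0.
have -> := ge0_integral_normal 0 (Num.sqrt t) mfr fr0.
apply: eq_integral => x _; rewrite -muleA -EFinM; congr (_ * _%:E).
rewrite !normal_pdf_sqrt// mulrCA -expRD; congr (_ * expR _)%R.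
by field; rewrite gt_eqF.
Qed.

Lemma measurable_dotrV n (y : 'rV[R]_n) :
  measurable_fun [set: 'rV[R]_n] (fun x => dotrV x y).
Proof.
apply: measurable_sum => i.
by apply: measurable_funM => //; exact: measurable_coord.
Qed.

Lemma dotrV_row_cons n a (b : 'rV[R]_n) y :
  dotrV (row_cons (a, b)) y = (a * y ord0 ord0 + dotrV b (rV_behead y))%R.
Proof.
rewrite /dotrV big_ord_recl row_cons0; congr (_ + _)%R.
by apply: eq_bigr => i _; rewrite row_consS mxE.
Qed.

Lemma sqnorm2_row_cons n a (b : 'rV[R]_n) :
  sqnorm2 (row_cons (a, b)) = (a ^+ 2 + sqnorm2 b)%R.
Proof.
rewrite /sqnorm2 big_ord_recl row_cons0; congr (_ + _)%R.
by apply: eq_bigr => i _; rewrite row_consS.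
Qed.

(** The exponent is the affine log-density called [l] later on. It is a sum over the coordinates, so
    the one-dimensional densities multiply up in the induction. *)
Lemma ge0_integral_gaussian_density n (y : 'rV[R]_n) t
    (f : 'rV[R]_n -> \bar R) :
  (0 < t)%R -> measurable_fun setT f -> (forall x, 0 <= f x) ->
  \int[gaussian y t]_x f x =
  \int[gaussian 0 t]_x
    (f x * (expR (dotrV x y / t - sqnorm2 y / (2 * t)))%:E).
Proof.
move=> t0; pose r k (y x : 'rV[R]_k) :=
  expR (dotrV x y / t - sqnorm2 y / (2 * t)).
have mr k (z : 'rV[R]_k) : measurable_fun [set: 'rV[R]_k] (EFin \o r k z).
  apply/measurable_EFinP; apply: measurableT_comp => //.
  apply: measurable_funB => //; apply: measurable_funM => //.
  exact: measurable_dotrV.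
have mfr k (z : 'rV[R]_k) (h : 'rV[R]_k -> \bar R) : measurable_fun setT h ->
    measurable_fun [set: 'rV[R]_k] (fun x => h x * (r k z x)%:E).
  by move=> mh; exact: emeasurable_funM mh (mr _ _).
have fr0 k (z : 'rV[R]_k) (h : 'rV[R]_k -> \bar R) : (forall x, 0 <= h x) ->
    forall x, 0 <= h x * (r k z x)%:E.
  by move=> h0 x; apply: mule_ge0; [exact: h0|rewrite lee_fin expR_ge0].
elim: n y f => [|n IH] y f mf f0.
  rewrite /= !integral_dirac// ?diracT ?mul1e; last exact: mfr.
  rewrite /dotrV /sqnorm2 !big_ord0 !mul0r subrr expR0 mule1.
  by congr f; apply/rowP => -[].
apply: etrans (ge0_integral_gaussianS y t mf f0) _.
apply: etrans _ (esym (ge0_integral_gaussianS 0 t (mfr _ y _ mf) (fr0 _ y _ f0))).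
rewrite rV_behead0 mxE.
have mfa a : measurable_fun setT (fun b : 'rV[R]_n => f (row_cons (a, b))).
  by apply: measurableT_comp => //; exact: measurable_row_cons2.
rewrite ge0_integral_normal_density; [|exact: t0| |]; first last.
- by move=> a; apply: integral_ge0 => b _; exact: f0.
- exact: measurable_integral_row_cons.
apply: eq_integral => a _; rewrite IH//.
rewrite -ge0_integralZr//; last 2 first.
- exact: (mfr _ (rV_behead y) _ (mfa a)).
- by move=> b _; apply: (fr0 _ (rV_behead y) (fun b => f (row_cons (a, b)))).
apply: eq_integral => b _; rewrite -muleA -EFinM /r -expRD.
congr (_ * (expR _)%:E); rewrite dotrV_row_cons.
rewrite -[in sqnorm2 y](row_consK y) sqnorm2_row_cons.
by field; rewrite gt_eqF.
Qed.

End gaussian_density.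

(** * Gaussian integrability of exponentials of a quadratic *)

Section gaussian_expsq.
Context (R : realType).
Implicit Types (t m c : R).
Local Open Scope ereal_scope.

Lemma measurable_sqnorm2 n : measurable_fun [set: 'rV[R]_n] (@sqnorm2 R n).
Proof.
apply: measurable_sum => i; apply: measurable_funX.
exact: measurable_coord.
Qed.

Lemma measurable_expR_sqnorm2 n c :
  measurable_fun [set: 'rV[R]_n] (fun x => (expR (c * sqnorm2 x))%:E).
Proof.
apply/measurable_EFinP; apply: measurableT_comp => //.
by apply: measurable_funM => //; exact: measurable_sqnorm2.
Qed.

Lemma normal_expR_sqr_lty m t c : (0 < t)%R -> (c < 1 / (2 * t))%R ->
  \int[normal_prob m (Num.sqrt t)]_x (expR (c * x ^+ 2))%:E < +oo.
Proof.
move=> t0 ct; set a := (1 / (2 * t) - c)%R.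
have a0 : (0 < a)%R by rewrite subr_gt0.
have me : measurable_fun [set: R] (fun x => (expR (c * x ^+ 2))%:E).
  apply/measurable_EFinP; apply: measurableT_comp => //.
  by apply: measurable_funM => //; exact: measurable_funX.
have -> := ge0_integral_normal m (Num.sqrt t) me
  (fun x => ltac:(by rewrite lee_fin expR_ge0)).
(* The integrand decays like [expR (- a * x ^+ 2 + x * m / t)]. Half of the rate [a] is kept for a
   centred normal density of variance [a^-1]; the other half absorbs the linear term at the cost
   [m ^+ 2 / (2 * a * t ^+ 2)]. *)
pose C : R := (normal_peak (Num.sqrt t) * expR (m ^+ 2 / (2 * a * t ^+ 2)) /
  normal_peak (Num.sqrt a^-1))%R.
have ps (s : R) : (0 < s)%R -> (0 < normal_peak (Num.sqrt s))%R.
  by move=> s0; rewrite normal_peak_gt0// gt_eqF// sqrtr_gt0.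
have mp s k : measurable_fun [set: R] (EFin \o normal_pdf k s).
  by apply/measurable_EFinP; exact: measurable_normal_pdf.
have C0 : (0 <= C)%R.
  by rewrite /C !mulr_ge0 ?expR_ge0 ?invr_ge0 ?normal_peak_ge0.
apply: (@le_lt_trans _ _ (\int[lebesgue_measure]_x
    (C%:E * (normal_pdf 0 (Num.sqrt a^-1) x)%:E))).
  apply: ge0_le_integral => //.
  - by move=> x _; rewrite -EFinM lee_fin mulr_ge0 ?expR_ge0 ?normal_pdf_ge0.
  - exact: emeasurable_funM me (mp _ _).
  - by apply: emeasurable_funM => //; exact: mp.
  - move=> x _; rewrite -!EFinM lee_fin !normal_pdf_sqrt ?invr_gt0// /C.
    rewrite (mulrA (_ / _)%R) divfK ?gt_eqF ?ps ?invr_gt0// mulrCA -!mulrA.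
    rewrite ler_pM2l ?ps// -!expRD ler_expR subr0.
    have -> : c = (1 / (2 * t) - a)%R by rewrite /a opprB addrC subrK.
    rewrite -subr_ge0.
    set d := (X in (0 <= X)%R).
    have -> : d = (a / 2 * (x - m / (a * t)) ^+ 2 + m ^+ 2 / (2 * t))%R.
      by rewrite /d; field; rewrite !gt_eqF.
    apply: addr_ge0; first by rewrite mulr_ge0 ?sqr_ge0// divr_ge0// ltW.
    by rewrite divr_ge0 ?sqr_ge0// mulr_ge0// ltW.
rewrite ge0_integralZl//; last 2 first.
- exact: mp.
- by move=> x _; rewrite lee_fin normal_pdf_ge0.
by rewrite integral_normal_pdf mule1 ltry.
Qed.

Lemma gaussian_expR_sqnorm2_lty n (y : 'rV[R]_n) t c : (0 < t)%R ->
  (c < 1 / (2 * t))%R ->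
  \int[gaussian y t]_x (expR (c * sqnorm2 x))%:E < +oo.
Proof.
move=> t0 ct; elim: n y => [|n IH] y.
  rewrite /= integral_dirac// ?diracT ?mul1e ?ltry//.
  exact: measurable_expR_sqnorm2.
rewrite ge0_integral_gaussianS; first last.
- by move=> x; rewrite lee_fin expR_ge0.
- exact: measurable_expR_sqnorm2.
set K := \int[gaussian (rV_behead y) t]_b (expR (c * sqnorm2 b))%:E.
have K0 : 0 <= K by apply: integral_ge0 => b _; rewrite lee_fin expR_ge0.
have mE := @measurable_expR_sqnorm2 n c.
rewrite (eq_integral (fun a : measurableTypeR R =>
  (expR (c * a ^+ 2))%:E * K)); last first.
  move=> a _; rewrite -ge0_integralZl//.
  by apply: eq_integral => b _; rewrite sqnorm2_row_cons mulrDr expRD EFinM.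
rewrite ge0_integralZr//; last first.
  apply/measurable_EFinP; apply: measurableT_comp => //.
  by apply: measurable_funM => //; exact: measurable_funX.
rewrite lte_mul_pinfty//.
- by apply: integral_ge0 => b _; rewrite lee_fin expR_ge0.
- rewrite ge0_fin_numE ?normal_expR_sqr_lty//.
  by apply: integral_ge0 => b _; rewrite lee_fin expR_ge0.
- exact: IH.
Qed.

Lemma integrable_expR_sqnorm2 n (y : 'rV[R]_n) t c k : (0 < t)%R ->
  (c < 1 / (2 * t))%R ->
  (gaussian y t).-integrable setT (fun x => (k * expR (c * sqnorm2 x))%:E).
Proof.
move=> t0 ct; under eq_fun do rewrite EFinM; apply: integrableZl => //.
apply/integrableP; split; first exact: measurable_expR_sqnorm2.
under eq_integral do rewrite gee0_abs ?lee_fin ?expR_ge0//.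
exact: gaussian_expR_sqnorm2_lty.
Qed.

End gaussian_expsq.

(** * Calculus with the normal density *)

Section normal_calculus.
Context (R : realType).
Implicit Types (t m c a b : R).
Local Open Scope ereal_scope.

Lemma integral_density d (T : measurableType d)
    (mu nu : {measure set T -> \bar R}) (p : T -> R) (D : set T)
    (f : T -> \bar R) :
  measurable_fun setT p -> (forall x, (0 <= p x)%R) ->
  (forall A, measurable A -> nu A = \int[mu]_(x in A) (p x)%:E) ->
  measurable D -> measurable_fun D f ->
  \int[nu]_(x in D) f x = \int[mu]_(x in D) (f x * (p x)%:E).
Proof.
move=> mp p0 nuE mD mf.
rewrite integral_mkcond [RHS]integral_mkcond.
have mfD : measurable_fun setT (f \_ D).
  by apply/(measurable_restrictT _ mD).
rewrite integralE [RHS]integralE.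
rewrite (ge0_integral_density mp p0 nuE)//; last exact: measurable_funepos.
rewrite (ge0_integral_density mp p0 nuE)//; last exact: measurable_funeneg.
have E x : ((fun x => f x * (p x)%:E) \_ D) x = (f \_ D) x * (p x)%:E.
  by rewrite !patchE; case: ifPn => //; rewrite mul0e.
congr (_ - _); apply: eq_integral => x _.
- rewrite !funeposE E; have : (0 <= (p x)%:E) by rewrite lee_fin.
  by move=> ?; rewrite maxe_pMl// mul0e.
- rewrite !funenegE E; have : (0 <= (p x)%:E) by rewrite lee_fin.
  by move=> ?; rewrite maxe_pMl// mul0e mulNe.
Qed.

Lemma integral_normal m s (D : set R) (f : R -> \bar R) : measurable D ->
  measurable_fun D f ->
  \int[normal_prob m s]_(x in D) f x =
  \int[lebesgue_measure]_(x in D) (f x * (normal_pdf m s x)%:E).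
Proof.
move=> mD mf; apply: integral_density => //.
- exact: measurable_normal_pdf.
- by move=> x; exact: normal_pdf_ge0.
Qed.

Lemma normal_pdf_gt0 m t x : (0 < t)%R -> (0 < normal_pdf m (Num.sqrt t) x)%R.
Proof.
move=> t0; rewrite normal_pdf_sqrt// mulr_gt0 ?expR_gt0//.
by rewrite normal_peak_gt0// gt_eqF// sqrtr_gt0.
Qed.

Lemma is_derive_normal_pdf m t (x : R) : (0 < t)%R ->
  is_derive x 1%R (normal_pdf m (Num.sqrt t))
    (- ((x - m) / t) * normal_pdf m (Num.sqrt t) x)%R.
Proof.
move=> t0; pose s := Num.sqrt t.
rewrite (_ : normal_pdf m _ = fun x =>
  normal_peak s * expR (- (x - m) ^+ 2 / (2 * t)))%R; last first.
  by apply/funext => y; rewrite normal_pdf_sqrt.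
have De : is_derive x 1%R (fun y => - (y - m) ^+ 2 / (2 * t))%R
    (- ((x - m) / t))%R.
  apply: is_derive_eq.
  by rewrite /= /GRing.scale /=; field; rewrite gt_eqF.
apply: is_derive_eq.
by rewrite /= /GRing.scale /=; ring.
Qed.

(** An open ray starting to the left of the segments used below gives two-sided derivatives at both
    of their end points. *)
Lemma antiderivative_ray (p : R -> R) c :
  (forall x, (c <= x)%R -> {for x, continuous p}) ->
  exists P : R -> R, forall x, (c < x)%R -> is_derive (x : R) 1%R P (p x).
Proof.
move=> cp; exists (fun x => \int[lebesgue_measure]_(y in `[c, x]) p y)%R.
move=> x cx.
have [] := @continuous_FTC1_closed R p c x (x + 1)%R.
- by rewrite ltrDl.
- apply: continuous_compact_integrable; first exact: segment_compact.
  apply: continuous_in_subspaceT => y /set_mem; rewrite /= in_itv/=.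
  by move=> /andP[cy _]; exact: cp.
- exact: cx.
- by apply: cp; exact: ltW.
by move=> dP P'; split; [exact: dP|rewrite -derive1E; exact: P'].
Qed.

(** Integrals over a segment are computed by exhibiting an antiderivative of [f] times the density,
    so that integration by parts becomes the check of a derivative. *)
Lemma integral_normal_FTC m t a b (f F : R -> R) : (0 < t)%R -> (a < b)%R ->
  (forall x, x \in `[a, b] -> {for x, continuous f}) ->
  (forall x, x \in `[a, b] ->
    is_derive x 1%R F (f x * normal_pdf m (Num.sqrt t) x)%R) ->
  \int[normal_prob m (Num.sqrt t)]_(x in `[a, b]) (f x)%:E = (F b - F a)%:E.
Proof.
move=> t0 ab cf dF.
have cw : {within `[a, b], continuous f}.
  by apply: continuous_in_subspaceT => x /set_mem; exact: cf.
rewrite integral_normal//; last first.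
  by apply/measurable_EFinP; apply: subspace_continuous_measurable_fun.
under eq_integral do rewrite -EFinM.
rewrite (continuous_FTC2 (F := F) ab) ?EFinB//.
- apply: continuous_in_subspaceT => x /set_mem xab; apply: cvgM.
    exact: cf.
  by apply: continuous_normal_pdf; rewrite gt_eqF// sqrtr_gt0.
- have cF x : x \in `[a, b] -> {for x, continuous F}.
    move=> /dF dFx; apply: differentiable_continuous.
    by apply/derivable1_diffP; case: dFx.
  split.
  + by move=> x /subset_itv_oo_cc /dF[].
  + by apply: cvg_at_right_filter; apply: cF; rewrite in_itv/= lexx ltW.
  + by apply: cvg_at_left_filter; apply: cF; rewrite in_itv/= lexx ltW.
- by move=> x /subset_itv_oo_cc /dF[_ <-]; rewrite derive1E.
Qed.

End normal_calculus.

(** * Poincare inequality on the line *)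

Section normal_poincare.
Context (R : realType).
Implicit Types (t m c a b : R).

(* Cauchy-Schwarz. It bounds the variance of [f] by the covariance of the
   identity with the monotone function [F]. *)
Lemma sqr_diff_le (f f' F : R -> R) c :
  (forall x, c < x -> is_derive x 1 f (f' x)) ->
  (forall x, c < x -> is_derive x 1 F (f' x ^+ 2)) ->
  forall a b, c < a -> c < b -> (f a - f b) ^+ 2 <= (a - b) * (F a - F b).
Proof.
move=> df dF.
suff H a b : c < a -> a <= b -> (f a - f b) ^+ 2 <= (a - b) * (F a - F b).
  move=> a b ca cb; have [ab|/ltW ba] := leP a b; first exact: H.
  by rewrite -sqrrN opprB -mulrNN !opprB; exact: H.
move=> ca; rewrite le_eqVlt => /predU1P[->|ab]; first by rewrite !subrr expr0n mul0r.
(* For this mean slope, [F - 2 * l * f + l ^+ 2 * x] has derivative [(f' - l) ^+ 2], so it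
   increases; comparing its values at [a] and [b] gives the claim. *)
pose l := (f b - f a) / (b - a).
have ba0 : 0 < b - a by rewrite subr_gt0.
have dG x : x \in `[a, b] ->
    is_derive x 1 (fun y => F y - 2 * l * f y + l ^+ 2 * y) ((f' x - l) ^+ 2).
  rewrite in_itv/= => /andP[ax _]; have cx := lt_le_trans ca ax.
  have ? := df _ cx; have ? := dF _ cx.
  apply: is_derive_eq; rewrite /GRing.scale/=; ring.
have : F a - 2 * l * f a + l ^+ 2 * a <= F b - 2 * l * f b + l ^+ 2 * b.
  apply: (@ger0_derive1_le_cc R (fun y => F y - 2 * l * f y + l ^+ 2 * y) a b).
  - by move=> x /subset_itv_oo_cc /dG[].
  - move=> x /subset_itv_oo_cc /dG[_]; rewrite derive1E => ->; exact: sqr_ge0.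
  - apply: derivable_within_continuous => x /dG[//].
  - by rewrite in_itv/= lexx ltW.
  - by rewrite in_itv/= lexx ltW.
  - exact: ltW.
have -> : (f a - f b) ^+ 2 = l ^+ 2 * (b - a) ^+ 2.
  by rewrite /l -sqrrN opprB -exprMn divfK// gt_eqF.
have fE : f b - f a = l * (b - a) by rewrite /l divfK// gt_eqF.
rewrite -subr_ge0 => h.
have : 0 <= (b - a) * (F b - F a - 2 * l * (f b - f a) + l ^+ 2 * (b - a)).
  apply: mulr_ge0; first exact: ltW.
  by apply: le_trans h _; rewrite le_eqVlt; apply/predU1P; left; ring.
rewrite fE => h2; rewrite -subr_ge0; apply: le_trans h2 _.
rewrite le_eqVlt; apply/predU1P; left; ring.
Qed.

(** Segments are centred at the mean for this reason: an antiderivative of [(x - m)] times the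
    density is [- t] times the density, and its increment over the segment is zero. *)
Lemma normal_pdf_sym m t N : 0 < t ->
  normal_pdf m (Num.sqrt t) (m - N) = normal_pdf m (Num.sqrt t) (m + N).
Proof.
move=> t0; rewrite (normal_pdf_sqrt _ _ t0) [RHS](normal_pdf_sqrt _ _ t0).
by rewrite !(addrC m) !addrK sqrrN.
Qed.

Section segment.
Variables (t m N : R) (f f' : R -> R).
Hypotheses (t0 : 0 < t) (N0 : 0 < N).
Hypotheses (df : forall x : R, is_derive x 1 f (f' x)) (cf' : continuous f').
Let P := normal_prob m (Num.sqrt t).
Let a := m - N.
Let b := m + N.
Let p := normal_pdf m (Num.sqrt t).

Local Open Scope ereal_scope.

(** With [F' = f' ^+ 2], [sqr_diff_le] bounds the integrand by [(x - y) * (F x - F y)]. Its integral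
    over the square is [2 * P [a, b]] times the integral of [(x - m) * F], because [x - m] has
    integral zero; by parts, the latter is at most [t] times the integral of [f' ^+ 2]. *)
Lemma normal_poincare_segment :
  \int[P \x P]_(z in `[a, b]%classic `*` `[a, b]%classic)
    ((f z.1 - f z.2) ^+ 2)%:E <=
  (2 * t)%:E * \int[P]_(x in `[a, b]) (f' x ^+ 2)%:E.
Proof.
have cp : continuous p by apply: continuous_normal_pdf; rewrite gt_eqF// sqrtr_gt0.
have ab : (a < b)%R by rewrite ltrD2l gtrN.
pose c := (a - 1)%R.
have ca : (c < a)%R by rewrite /c; lra.
have cab x : x \in `[a, b] -> (c < x)%R.
  by rewrite in_itv/= => /andP[ax _]; exact: lt_le_trans ax.
have cf'2 : continuous (fun x => f' x ^+ 2)%R.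
  by move=> x; apply: cvgM; exact: cf'.
(* One more unit of room: [F] enters integrands that start at [c], so it has to be continuous at [c]
   itself. *)
have [F dF] := antiderivative_ray (c := (c - 1)%R) (fun x _ => cf'2 x).
have dF' x : (c < x)%R -> is_derive x 1%R F (f' x ^+ 2)%R.
  by move=> cx; apply: dF; lra.
have Fle := sqr_diff_le (fun x _ => df x) dF'.
have cF x : (c <= x)%R -> {for x, continuous F}.
  move=> cx; have dFx := dF x ltac:(lra); apply: differentiable_continuous.
  by apply/derivable1_diffP; case: dFx.
pose u x := (x - m)%R.
have cu : continuous u by move=> x; apply: cvgB => //; exact: cvg_cst.
have [L dL] := @antiderivative_ray R (fun x => u x * F x * p x)%R c
  (fun x cx => cvgM (cvgM (cu x) (cF x cx)) (cp x)).
have [M dM] := @antiderivative_ray R (fun x => F x * p x)%R c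
  (fun x cx => cvgM (cF x cx) (cp x)).
have [K dK] := @antiderivative_ray R p c (fun x cx => cp x).
have [W dW] := @antiderivative_ray R (fun x => f' x ^+ 2 * p x)%R c
  (fun x cx => cvgM (cf'2 x) (cp x)).
have dp x := is_derive_normal_pdf m x t0.
have pab : p a = p b.
  exact: normal_pdf_sym.
have FTC (h H : R -> R) : (forall x, (c <= x)%R -> {for x, continuous h}) ->
    (forall x : R, (c < x)%R -> is_derive x 1%R H (h x * p x)%R) ->
    \int[P]_(x in `[a, b]) (h x)%:E = (H b - H a)%:E.
  move=> ch dH; apply: integral_normal_FTC => // x /cab; [move/ltW|]; auto.
have ccst k : forall x, (c <= x)%R -> {for x, continuous (fun _ : R => k : R)}.
  by move=> x _; exact: cvg_cst.
have KE : P `[a, b]%classic = (K b - K a)%:E.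
  have dK1 (x : R) : (c < x)%R -> is_derive x 1%R K (1 * p x)%R.
    by move=> /dK; rewrite mul1r.
  have <- := FTC _ _ (ccst 1%R) dK1.
  by rewrite integral_cst//= mul1e.
have WE : \int[P]_(x in `[a, b]) (f' x ^+ 2)%:E = (W b - W a)%:E.
  exact: (FTC _ _ (fun x _ => cf'2 x)).
(* [u p = (- t p)'] and integration by parts against the monotone [F] *)
have LW : (L b - L a <= t * (W b - W a))%R.
  have : (t * (W b - W a) - (L b - L a) = t * p b * (F b - F a))%R.
    have ch x : (c <= x)%R ->
        {for x, continuous (fun x => t * f' x ^+ 2 - u x * F x)%R}.
      move=> cx; apply: cvgB; first by apply: cvgM; [exact: cvg_cst|exact: cf'2].
      by apply: cvgM; [exact: cu|exact: cF].
    have d1 (x : R) : (c < x)%R -> is_derive x 1%R (fun x => t * p x * F x)%R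
        ((t * f' x ^+ 2 - u x * F x) * p x)%R.
      move=> cx; have := dF' _ cx; have := dp x => ? ?.
      apply: is_derive_eq; rewrite /GRing.scale/= /u -/p; field.
      by rewrite gt_eqF.
    have d2 (x : R) : (c < x)%R -> is_derive x 1%R (fun x => t * W x - L x)%R
        ((t * f' x ^+ 2 - u x * F x) * p x)%R.
      move=> cx; have := dW _ cx; have := dL _ cx => ? ?.
      by apply: is_derive_eq; rewrite /GRing.scale/=; ring.
    have := FTC _ _ ch d1; rewrite (FTC _ _ ch d2) pab => -[] e.
    by move: e; rewrite -mulrBr => <-; ring.
  rewrite -subr_ge0 => ->; apply: mulr_ge0.
    by rewrite mulr_ge0 ?ltW// normal_pdf_gt0.
  have := Fle a b ca (lt_trans ca ab) => h.
  have : (0 <= (b - a) * (F b - F a))%R.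
    by rewrite -mulrNN !opprB; apply: le_trans h; exact: sqr_ge0.
  by rewrite pmulr_rge0// subr_gt0.
have K1 : (0 <= K b - K a <= 1)%R.
  rewrite -!lee_fin -KE; apply/andP; split=> //.
  by rewrite -(@probability_setT _ _ _ P); apply: le_measure; rewrite ?inE.
have W0 : (0 <= W b - W a)%R.
  rewrite -lee_fin -WE; apply: integral_ge0 => x _.
  by rewrite lee_fin sqr_ge0.
have inner x : x \in `[a, b] ->
    \int[P]_(y in `[a, b]) ((x - y) * (F x - F y))%:E =
    ((L b - L a) - u x * (M b - M a) + u x * F x * (K b - K a))%:E.
  move=> xab.
  have ch y : (c <= y)%R -> {for y, continuous (fun y => (x - y) * (F x - F y))%R}.
    move=> cy; apply: cvgM; apply: cvgB; [exact: cvg_cst|exact: cvg_id| |].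
      exact: cvg_cst.
    exact: cF.
  (* Write [x - y] as [u x - u y] and expand. The term [- F x * u y * p y] has antiderivative
     [F x * (t * p y)], whose increment vanishes by [pab]. *)
  have d (y : R) : (c < y)%R -> is_derive y 1%R
      (fun y => L y + F x * (t * p y) - u x * M y + u x * F x * K y)%R
      ((x - y) * (F x - F y) * p y)%R.
    move=> cy; have ? := dL _ cy; have ? := dM _ cy; have ? := dK _ cy.
    have ? := dp y.
    apply: is_derive_eq; rewrite /GRing.scale/= /u -/p; field.
    by rewrite gt_eqF.
  by rewrite (FTC _ _ ch d) pab; congr EFin; ring.
have outer : \int[P]_(x in `[a, b])
    ((L b - L a) - u x * (M b - M a) + u x * F x * (K b - K a))%:E =
    (2 * (L b - L a) * (K b - K a))%:E.
  set dL' := (L b - L a)%R; set dM' := (M b - M a)%R; set dK' := (K b - K a)%R.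
  have ch y : (c <= y)%R ->
      {for y, continuous (fun y => dL' - u y * dM' + u y * F y * dK')%R}.
    move=> cy; apply: cvgD.
      apply: cvgB; first exact: cvg_cst.
      by apply: cvgM; [exact: cu|exact: cvg_cst].
    apply: cvgM; last exact: cvg_cst.
    by apply: cvgM; [exact: cu|exact: cF].
  have d (y : R) : (c < y)%R -> is_derive y 1%R
      (fun y => dL' * K y + t * p y * dM' + L y * dK')%R
      ((dL' - u y * dM' + u y * F y * dK') * p y)%R.
    move=> cy; have ? := dL _ cy; have ? := dM _ cy; have ? := dK _ cy.
    have ? := dp y.
    apply: is_derive_eq; rewrite /GRing.scale/= /u -/p; field.
    by rewrite gt_eqF.
  by rewrite (FTC _ _ ch d) pab; congr EFin; rewrite /dL' /dK'; ring.
pose Q x := (L b - L a - u x * (M b - M a) + u x * F x * (K b - K a))%R.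
have mf : measurable_fun [set: R] f.
  apply: continuous_measurable_fun => x; apply: differentiable_continuous.
  by apply/derivable1_diffP; case: (df x).
have le1 x : x \in `[a, b] ->
    \int[P]_(y in `[a, b]) ((f x - f y) ^+ 2)%:E <= (Q x)%:E.
  move=> xab; rewrite -inner//; apply: ge0_le_integral => //.
  - by move=> y _; rewrite lee_fin sqr_ge0.
  - apply/measurable_EFinP; apply: measurable_funTS.
    by apply: measurable_funX; apply: measurable_funB.
  - apply/measurable_EFinP; apply: subspace_continuous_measurable_fun => //.
    apply: continuous_in_subspaceT => y /set_mem /cab/ltW cy.
    apply: cvgM; apply: cvgB; [exact: cvg_cst|exact: cvg_id| |].
      exact: cvg_cst.
    exact: cF.
  - by move=> y yab; rewrite lee_fin; apply: Fle; exact: cab.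
have mQ : measurable_fun setT ((EFin \o Q) \_ `[a, b]).
  apply/(measurable_restrictT _ _).1 => //; apply/measurable_EFinP.
  apply: subspace_continuous_measurable_fun => //.
  apply: continuous_in_subspaceT => y /set_mem /cab/ltW cy.
  apply: cvgD.
    apply: cvgB; first exact: cvg_cst.
    by apply: cvgM; [exact: cu|exact: cvg_cst].
  apply: cvgM; last exact: cvg_cst.
  by apply: cvgM; [exact: cu|exact: cF].
pose T := measurableTypeR R.
pose I : set T := `[a, b]%classic.
pose g (z : T * T) : \bar R :=
  ((f z.1 - f z.2) ^+ 2)%:E.
have mg : measurable_fun [set: T * T] g.
  apply/measurable_EFinP; apply: measurable_funX; apply: measurable_funB.
    by apply: measurableT_comp => //; exact: measurable_fst.
  by apply: measurableT_comp => //; exact: measurable_snd.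
have mII : measurable (I `*` I : set (T * T)).
  by apply: measurableX; exact: measurable_itv.
have mgI : measurable_fun [set: T * T] (g \_ (I `*` I)).
  by apply/(measurable_restrictT _ _).1 => //; exact: measurable_funTS.
have g0 z : 0 <= (g \_ (I `*` I)) z.
  by apply: erestrict_ge0 => ? _; rewrite lee_fin sqr_ge0.
have -> : \int[P \x P]_(z in I `*` I) g z =
    \int[P]_x \int[P]_y (g \_ (I `*` I)) (x, y).
  by rewrite integral_mkcond; exact: (fubini_tonelli1 _ mgI g0).
apply: (@le_trans _ _ (\int[P]_(x in `[a, b]) (Q x)%:E)).
  rewrite [leRHS]integral_mkcond; apply: ge0_le_integral => //.
  - by move=> x _; apply: integral_ge0.
  - exact: measurable_fun_fubini_tonelli_F.
  - move=> x _; rewrite /fubini_F patchE; case: ifPn => [/set_mem xI|xI].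
      rewrite -[leRHS]/((Q x)%:E); apply: le_trans (le1 _ xI).
      rewrite [leRHS]integral_mkcond le_eqVlt; apply/predU1P; left.
      apply: eq_integral => y _; rewrite !patchE in_setX/=.
      by rewrite (mem_set xI).
    rewrite integral0_eq// => y _; rewrite patchE in_setX/=.
    by rewrite (negbTE xI).
rewrite outer WE -EFinM lee_fin.
apply: (@le_trans _ _ (2 * (t * (W b - W a)) * (K b - K a))%R).
  by rewrite ler_wpM2r//; [case/andP: K1|rewrite ler_pM2l].
rewrite mulrA ler_piMr//; last by case/andP: K1.
by rewrite !mulr_ge0// ltW.
Qed.
End segment.

(** The half-width is [i.+1] rather than [i] so that the first segment is not reduced to a point. *)
Lemma nondecreasing_itv_center m :
  nondecreasing_seq (fun i : nat => `[m - i.+1%:R, m + i.+1%:R]%classic : set R).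
Proof.
move=> i j ij; apply/subsetPset => x /=; rewrite !in_itv/= => /andP[x1 x2].
have : i.+1%:R <= j.+1%:R :> R by rewrite ler_nat.
move: (i.+1%:R : R) (j.+1%:R : R) x1 x2 => u v; lra.
Qed.

Lemma itv_center_near m x : exists k : nat, forall i : nat, (k <= i)%N ->
  x \in `[m - i.+1%:R, m + i.+1%:R].
Proof.
exists (Num.bound `|x - m|) => i ki; rewrite in_itv/=.
have : `|x - m| < i.+1%:R.
  apply: lt_le_trans (archi_boundP (normr_ge0 _)) _.
  by rewrite ler_nat leqW.
rewrite ltr_norml => /andP[]; move: (i.+1%:R : R) => u; lra.
Qed.

Local Open Scope ereal_scope.

(** Both integrands are nonnegative, so the segment version passes to the limit by monotone
    convergence along the increasing squares, even when an integral is infinite. *)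
Lemma normal_poincare m t (f f' : R -> R) : (0 < t)%R ->
  (forall x : R, is_derive x 1%R f (f' x)) -> continuous f' ->
  \int[normal_prob m (Num.sqrt t)]_x \int[normal_prob m (Num.sqrt t)]_y
    ((f x - f y) ^+ 2)%:E <=
  (2 * t)%:E * \int[normal_prob m (Num.sqrt t)]_x (f' x ^+ 2)%:E.
Proof.
move=> t0 df cf'; pose P := normal_prob m (Num.sqrt t).
pose T := measurableTypeR R.
pose g (z : T * T) : \bar R := ((f z.1 - f z.2) ^+ 2)%:E.
have mf : measurable_fun [set: R] f.
  apply: continuous_measurable_fun => x; apply: differentiable_continuous.
  by apply/derivable1_diffP; case: (df x).
have mg : measurable_fun [set: T * T] g.
  apply/measurable_EFinP; apply: measurable_funX; apply: measurable_funB.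
    by apply: measurableT_comp => //; exact: measurable_fst.
  by apply: measurableT_comp => //; exact: measurable_snd.
have g0 z : 0 <= g z by rewrite lee_fin sqr_ge0.
have mf' : measurable_fun [set: R] (fun x => (f' x ^+ 2)%:E).
  apply/measurable_EFinP; apply: measurable_funX.
  exact: continuous_measurable_fun.
rewrite -[leLHS](fubini_tonelli1 g mg g0).
pose I (i : nat) : set T := `[(m - i.+1%:R)%R, (m + i.+1%:R)%R]%classic.
have mI i : measurable (I i) by exact: measurable_itv.
have := @ge0_nondecreasing_set_cvg_integral _ (T * T)%type R
  (fun i => I i `*` I i) g (P \x P).
have -> : \bigcup_i (I i `*` I i) = [set: T * T].
  apply/seteqP; split => // -[x y] _.
  have [k1 h1] := itv_center_near m x; have [k2 h2] := itv_center_near m y.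
  exists (maxn k1 k2) => //; split; [apply: h1|apply: h2].
    exact: leq_maxl.
  exact: leq_maxr.
move=> cvgI; apply: cvge_le (cvgI _ _ _ _).
- apply: nearW => i; rewrite /I.
  have i0 : (0 < i.+1%:R :> R)%R by rewrite ltr0n.
  apply: le_trans (normal_poincare_segment m t0 i0 df cf') _.
  apply: lee_wpmul2l; first by rewrite lee_fin mulr_ge0// ltW.
  by apply: ge0_subset_integral => // x _; rewrite lee_fin sqr_ge0.
- move=> i j ij; have /subsetPset Iij := nondecreasing_itv_center m ij.
  by apply/subsetPset => -[x y] [/= Ix Iy]; split; exact: Iij.
- by move=> i; exact: measurableX.
- by move=> i; exact: measurable_funTS.
- by move=> i z _; exact: g0.
Qed.

End normal_poincare.

(** * Dual transport inequality *)

Lemma ae_le_integral d (T : measurableType d) (R : realType)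
    (mu : {measure set T -> \bar R}) (D : set T) (f g : T -> \bar R) :
  measurable D -> mu.-integrable D f -> mu.-integrable D g ->
  {ae mu, forall x, D x -> (f x <= g x)%E} ->
  (\int[mu]_(x in D) f x <= \int[mu]_(x in D) g x)%E.
Proof.
move=> mD fi gi [N [mN muN fgN]].
rewrite (negligible_integral mN mD fi muN) (negligible_integral mN mD gi muN).
apply: le_integral.
- exact: measurableD.
- by apply: integrableS fi => //; exact: measurableD.
- by apply: integrableS gi => //; exact: measurableD.
- move=> x /set_mem [Dx Nx]; rewrite leNgt; apply/negP => gf; apply: Nx.
  by apply: fgN => /= /(_ Dx); rewrite leNgt gf.
Qed.

Section transport.
Context (R : realType).
Implicit Types (c a b : R) (F G p q : R -> R).

Lemma derive_gt0_lt c F p :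
  (forall x, c < x -> is_derive x 1 F (p x)) -> (forall x, c < x -> 0 < p x) ->
  forall x y, c < x -> x < y -> F x < F y.
Proof.
move=> dF p0 x y cx xy.
have d z : z \in `[x, y] -> is_derive z 1 F (p z).
  by rewrite in_itv/= => /andP[xz _]; apply: dF; exact: lt_le_trans xz.
have d' z : z \in `]x, y[ -> is_derive z 1 F (p z).
  by move=> /subset_itv_oo_cc; exact: d.
have cF : {within `[x, y], continuous F}.
  by apply: derivable_within_continuous => z /d[].
have [z zxy e] := MVT xy d' cF.
rewrite -subr_gt0 e mulr_gt0 ?subr_gt0// p0//.
by move: zxy; rewrite in_itv/= => /andP[xz _]; exact: lt_trans xz.
Qed.

Lemma is_derive1_continuous F (x l : R) : is_derive x 1 F l ->
  {for x, continuous F}.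
Proof.
move=> dFx; apply: differentiable_continuous.
by apply/derivable1_diffP; case: dFx.
Qed.

(** [T x] is the point where [G] has covered the same fraction of its increment over [[a, b]] as [F]
    has at [x]. Differentiating that relation gives the derivative of [T]. *)
Lemma monotone_transport c a b F G p q : c < a -> a < b ->
  (forall x, c < x -> is_derive x 1 F (p x)) -> (forall x, c < x -> 0 < p x) ->
  (forall x, c < x -> is_derive x 1 G (q x)) -> (forall x, c < x -> 0 < q x) ->
  exists T : R -> R, [/\ T a = a, T b = b &
    forall x, x \in `[a, b] -> T x \in `[a, b] /\
      is_derive x 1 T ((G b - G a) / (F b - F a) * p x / q (T x))].
Proof.
move=> ca ab dF p0 dG q0; set k := (_ / _).
have Finc := derive_gt0_lt dF p0; have Ginc := derive_gt0_lt dG q0.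
have F0 : 0 < F b - F a by rewrite subr_gt0 Finc.
have G0 : 0 < G b - G a by rewrite subr_gt0 Ginc.
have k0 : 0 < k by rewrite divr_gt0.
(* [G] is inverted on a larger segment, so that the inverse is differentiable from both sides at
   [G a] and [G b]. *)
pose a' := (c + a) / 2; pose b' := b + 1.
have [ca' a'a bb'] : [/\ c < a', a' < a & b < b'].
  by rewrite /a' /b'; split; lra.
have Ginj x y : c < x -> c < y -> G x = G y -> x = y.
  move=> cx cy e; have [xy|yx|//] := ltgtP x y.
    by have := Ginc _ _ cx xy; rewrite e ltxx.
  by have := Ginc _ _ cy yx; rewrite e ltxx.
(* The inverse of [G] on [[a', b']]; off the image of that segment it takes the default value
   [a]. *)
pose H s := xget a [set y | y \in `[a', b'] /\ G y = s].
have HK y : y \in `[a', b'] -> H (G y) = y.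
  move=> yab; rewrite /H; case: xgetP => [z _ [zab e]|/(_ y)]; last first.
    by case; split.
  apply: Ginj => //.
    by move: zab; rewrite in_itv/= => /andP[z1 _]; exact: lt_le_trans z1.
  by move: yab; rewrite in_itv/= => /andP[z1 _]; exact: lt_le_trans z1.
pose S x := G a + k * (F x - F a).
have Sa : S a = G a by rewrite /S subrr mulr0 addr0.
have Sb : S b = G b by rewrite /S /k divfK ?gt_eqF// addrC subrK.
have HS x : x \in `[a, b] -> exists2 y, y \in `[a, b] & G y = S x.
  rewrite in_itv/= => /andP[ax xb]; have cx := lt_le_trans ca ax.
  apply: IVT; first exact: ltW.
    apply: derivable_within_continuous => z; rewrite in_itv/= => /andP[az _].
    by case: (dG z (lt_le_trans ca az)).
  have Gab : G a <= G b by exact/ltW/Ginc.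
  rewrite min_l// max_r//; apply/andP; split.
    rewrite -Sa lerD2l ler_pM2l// lerB//.
    by move: ax; rewrite le_eqVlt => /predU1P[->//|/(Finc _ _ ca)/ltW].
  rewrite -Sb lerD2l ler_pM2l// lerB//.
  by move: xb; rewrite le_eqVlt => /predU1P[->//|/(Finc _ _ cx)/ltW].
have sub y : y \in `[a, b] -> y \in `[a', b'].
  rewrite !in_itv/= => /andP[h1 h2]; apply/andP; split.
    by apply: le_trans h1; exact: ltW.
  by apply: le_trans h2 _; exact: ltW.
exists (H \o S); split => /=.
- by rewrite Sa HK// sub// in_itv/= lexx ltW.
- by rewrite Sb HK// sub// in_itv/= lexx ltW.
move=> x xab; have [y yab Gy] := HS x xab.
have Hy : H (S x) = y by rewrite -Gy HK// sub.
have [cx cy] : c < x /\ c < y.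
  move: xab yab; rewrite !in_itv/= => /andP[h1 _] /andP[h2 _].
  by split; exact: lt_le_trans ca _.
rewrite /= Hy; split=> //.
have yo : y \in `]a', b'[.
  move: yab; rewrite !in_itv/= => /andP[h1 h2].
  by rewrite (lt_le_trans a'a h1) (le_lt_trans h2 bb').
have nearG : \forall z \near y, z \in `]a', b'[ by exact: near_in_itvoo.
have dH : is_derive (S x) 1 H (q y)^-1.
  rewrite -Gy; apply: is_derive_inverse.
  - near=> z; apply: HK; apply: subset_itv_oo_cc; near: z; exact: nearG.
  - near=> z; have : z \in `]a', b'[ by near: z; exact: nearG.
    rewrite in_itv/= => /andP[a'z _]; apply: is_derive1_continuous.
    by apply: dG; exact: lt_trans a'z.
  - exact: dG.
  - by rewrite gt_eqF// q0.
have dS : is_derive x 1 S (k * p x).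
  have ? := dF _ cx; apply: is_derive_eq.
  by rewrite /GRing.scale/= subr0 add0r mul1r.
have := @is_derive1_comp R H S x _ _ dH dS.
by rewrite mulrC.
Unshelve. all: by end_near.
Qed.

End transport.

Section normal_dual_talagrand.
Context (R : realType).
Implicit Types (m t N : R).
Local Open Scope ereal_scope.

Lemma integrable_normal_segment m t a b (f : R -> R) : (0 < t)%R ->
  (forall x, x \in `[a, b] -> {for x, continuous f}) ->
  (normal_prob m (Num.sqrt t)).-integrable `[a, b] (EFin \o f).
Proof.
move=> t0 cf.
have cw : {within `[a, b], continuous f}.
  by apply: continuous_in_subspaceT => x /set_mem; exact: cf.
have mf : measurable_fun `[a, b] f.
  exact: subspace_continuous_measurable_fun.
apply/integrableP; split; first exact/measurable_EFinP.
rewrite integral_normal//; last first.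
  by apply: measurableT_comp => //; exact/measurable_EFinP.
have : lebesgue_measure.-integrable `[a, b]
    (EFin \o (fun x => f x * normal_pdf m (Num.sqrt t) x)%R).
  apply: continuous_compact_integrable; first exact: segment_compact.
  apply: continuous_in_subspaceT => x /set_mem xab; apply: cvgM; first exact: cf.
  by apply: continuous_normal_pdf; rewrite gt_eqF// sqrtr_gt0.
move=> /integrableP[_]; apply: le_lt_trans.
rewrite le_eqVlt; apply/predU1P; left; apply: eq_integral => x _ /=.
by rewrite normrM EFinM (ger0_norm (normal_pdf_ge0 _ _ _)).
Qed.

Section segment.
Variables (m t N : R) (g : R -> R) (h : R -> \bar R).
Hypotheses (t0 : (0 < t)%R) (N0 : (0 < N)%R) (cg : continuous g).
Let P := normal_prob m (Num.sqrt t).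
Hypothesis hi : P.-integrable setT h.
Hypothesis gh : {ae P, forall x, forall z,
  (g z)%:E <= h x + ((x - z) ^+ 2 / (2 * t))%:E}.
Let a : R := (m - N)%R.
Let b : R := (m + N)%R.

(** Transport takes place between the normalizations of the two densities on [[a, b]]. The mass of
    the segment stays as a factor and tends to 1 when the segment grows. *)
Lemma normal_dual_talagrand_segment : exists2 Z : R, (0 < Z)%R &
  \int[P]_(x in `[a, b]) (expR (g x))%:E = Z%:E /\
  P `[a, b]%classic * (ln Z)%:E <= \int[P]_(x in `[a, b]) h x.
Proof.
pose p := normal_pdf m (Num.sqrt t).
have cp : continuous p.
  by apply: continuous_normal_pdf; rewrite gt_eqF// sqrtr_gt0.
have p0 x : (0 < p x)%R by exact: normal_pdf_gt0.
have ab : (a < b)%R by rewrite ltrD2l gtrN.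
pose c := (a - 1)%R.
have ca : (c < a)%R by rewrite /c; lra.
have cab x : x \in `[a, b] -> (c < x)%R.
  by rewrite in_itv/= => /andP[ax _]; exact: lt_le_trans ax.
pose q x := (expR (g x) * p x)%R.
have ceg : continuous (fun x => expR (g x)).
  by move=> x; apply: continuous_comp; [exact: cg|exact: continuous_expR].
have cq : continuous q by move=> x; apply: cvgM; [exact: ceg|exact: cp].
have q0 x : (0 < q x)%R by rewrite mulr_gt0// expR_gt0.
have [K dK] := @antiderivative_ray R p c (fun x cx => cp x).
have [G dG] := @antiderivative_ray R q c (fun x cx => cq x).
have FTC (k H : R -> R) : (forall x, x \in `[a, b] -> {for x, continuous k}) ->
    (forall x : R, x \in `[a, b] -> is_derive x 1%R H (k x * p x)%R) ->
    \int[P]_(x in `[a, b]) (k x)%:E = (H b - H a)%:E.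
  by move=> ck dH; exact: integral_normal_FTC.
have KE : P `[a, b]%classic = (K b - K a)%:E.
  have ccst x : x \in `[a, b] -> {for x, continuous (fun _ : R => 1%R : R)}.
    by move=> _; exact: cvg_cst.
  have dK1 (x : R) : x \in `[a, b] -> is_derive x 1%R K (1 * p x)%R.
    by move=> /cab/dK; rewrite mul1r.
  have <- := FTC _ _ ccst dK1.
  by rewrite integral_cst//= mul1e.
have GE : \int[P]_(x in `[a, b]) (expR (g x))%:E = (G b - G a)%:E.
  exact: (FTC _ _ (fun x _ => ceg x) (fun x xab => dG x (cab x xab))).
set Z := (G b - G a)%R in GE; set k := (K b - K a)%R in KE.
have Kinc := derive_gt0_lt dK (fun x _ => p0 x).
have Ginc := derive_gt0_lt dG (fun x _ => q0 x).
have Z0 : (0 < Z)%R by rewrite subr_gt0 Ginc.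
have k0 : (0 < k)%R by rewrite subr_gt0 Kinc.
have k1 : (k <= 1)%R.
  rewrite -lee_fin -KE -(@probability_setT _ _ _ P).
  by apply: le_measure; rewrite ?inE.
exists Z => //; split; first exact: GE.
(* [T] carries the normalization of [p] on [[a, b]] to that of [q]; the claim is
   the cost inequality at [z = T x], with [ln T' <= T' - 1]. *)
have [T [Ta Tb dT]] :=
  monotone_transport ca ab dK (fun x _ => p0 x) dG (fun x _ => q0 x).
rewrite -/Z -/k in dT.
pose T' x := (Z / k * p x / q (T x))%R.
pose r x := (T' x - 1 + (x - m) * (x - T x) / t)%R.
have T'0 x : (0 < T' x)%R by rewrite /T' divr_gt0// mulr_gt0// divr_gt0.
have dTx (x : R) : x \in `[a, b] -> is_derive x 1%R T (T' x) by move=> /dT[].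
have cT x : x \in `[a, b] -> {for x, continuous T}.
  by move=> /dTx/is_derive1_continuous.
have cr x : x \in `[a, b] -> {for x, continuous (fun x => ln (Z / k) - r x)%R}.
  move=> xab; apply: cvgB; first exact: cvg_cst.
  apply: cvgD.
    apply: cvgB; last exact: cvg_cst.
    apply: cvgM; first by apply: cvgM; [exact: cvg_cst|exact: cp].
    apply: cvgV; first by rewrite gt_eqF.
    by apply: continuous_comp; [exact: cT|exact: cq].
  apply: cvgM; last exact: cvg_cst.
  apply: cvgM; first by apply: cvgB; [exact: cvg_id|exact: cvg_cst].
  by apply: cvgB; [exact: cvg_id|exact: cT].
(* [((T x - x) p)' = r p], and [T] fixes both end points *)
have dr (x : R) : x \in `[a, b] -> is_derive x 1%R
    (fun x => ln (Z / k) * K x - (T x - x) * p x)%R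
    ((ln (Z / k) - r x) * p x)%R.
  move=> xab; have ? := dK _ (cab _ xab); have ? := dTx _ xab.
  have ? := is_derive_normal_pdf m x t0.
  apply: is_derive_eq; rewrite /GRing.scale/= -/p /r; field.
  by rewrite gt_eqF.
have intr : \int[P]_(x in `[a, b]) (ln (Z / k) - r x)%:E = (k * ln (Z / k))%:E.
  by rewrite (FTC _ _ cr dr) Ta Tb; congr EFin; rewrite /k; ring.
(* Since [k <= 1], dividing [Z] by [k] can only raise the logarithm. *)
apply: (@le_trans _ _ (k * ln (Z / k))%:E).
  rewrite KE -EFinM lee_fin ler_pM2l// ln_div ?posrE//.
  by rewrite lerBrDr gerDl ln_le0.
rewrite -intr; apply: ae_le_integral.
- exact: measurable_itv.
- exact: (integrable_normal_segment m t0 cr).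
- by apply: integrableS hi => //; exact: measurable_itv.
- have [Y [mY Y0 ghY]] := gh; exists Y; split => // x /= nle; apply: ghY => /= ghx.
  apply: nle => xab.
  apply: (@le_trans _ _ ((g (T x))%:E - ((x - T x) ^+ 2 / (2 * t))%:E)).
    rewrite -EFinB lee_fin.
    have hp : (p x * expR (((x - m) ^+ 2 - (T x - m) ^+ 2) / (2 * t)))%R = p (T x).
      rewrite /p (normal_pdf_sqrt _ _ t0) [RHS](normal_pdf_sqrt _ _ t0).
      rewrite -mulrA -expRD; congr (_ * expR _)%R; field.
      by rewrite gt_eqF.
    (* Logarithm of the change of variables equation [T' x * q (T x) = Z / k * p x], the quotient of
       densities being given by [hp]. *)
    have e : ln (Z / k) = (ln (T' x) + g (T x) +
        ((x - m) ^+ 2 - (T x - m) ^+ 2) / (2 * t))%R.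
      apply: expR_inj; rewrite !expRD !lnK ?posrE ?T'0 ?divr_gt0//.
      rewrite /T' /q -hp; move: (expR_gt0 (g (T x))) (p0 x) k0 => e0 px0 k0'.
      move: (expR_gt0 (((x - m) ^+ 2 - (T x - m) ^+ 2) / (2 * t))%R).
      move: (expR _) => d d0; field.
      by rewrite !gt_eqF.
    have : (ln (T' x) <= T' x - 1)%R.
      rewrite -{1}[T' x](subrK 1%R) addrC; apply: le_ln1Dx.
      by rewrite ltrBrDl subrr.
    rewrite e /r => lnT.
    have -> : (((x - m) ^+ 2 - (T x - m) ^+ 2) / (2 * t) =
      (x - m) * (x - T x) / t - (x - T x) ^+ 2 / (2 * t))%R.
      by field; rewrite gt_eqF.
    move: ((x - m) * (x - T x) / t)%R ((x - T x) ^+ 2 / (2 * t))%R lnT => u v.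
    by move: (ln (T' x)) (g (T x)) (T' x) => l w z; lra.
  by rewrite leeBlDr//; exact: ghx.
Qed.

End segment.

Lemma bigcup_itv_center m :
  \bigcup_(i : nat) `[(m - i.+1%:R)%R, (m + i.+1%:R)%R]%classic = [set: R].
Proof.
apply/seteqP; split => // x _; have [k hk] := itv_center_near m x.
by exists k => //=; exact: hk.
Qed.

Lemma ge0_cvg_integral_itv_center (mu : {measure set (measurableTypeR R) -> \bar R})
    m (f : R -> \bar R) : measurable_fun [set: R] f -> (forall x, 0 <= f x) ->
  \int[mu]_(x in `[(m - i.+1%:R)%R, (m + i.+1%:R)%R]) f x @[i --> \oo] -->
  \int[mu]_x f x.
Proof.
move=> mf f0.
pose I (i : nat) : set (measurableTypeR R) :=
  `[(m - i.+1%:R)%R, (m + i.+1%:R)%R]%classic.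
have mI i : measurable (I i) by exact: measurable_itv.
rewrite -[X in _ --> \int[mu]_(x in X) _](bigcup_itv_center m).
apply: (@ge0_nondecreasing_set_cvg_integral _ _ R I f mu) => //.
- exact: nondecreasing_itv_center.
- by move=> i; exact: measurable_funS mf.
Qed.

(** [h] is extended-real and the cost inequality holds almost everywhere because, in higher
    dimension, [h] will be a fibre integral, which is finite only for almost every fibre. *)
Lemma normal_dual_talagrand m t (g : R -> R) (h : R -> \bar R)
    (P := normal_prob m (Num.sqrt t)) : (0 < t)%R -> continuous g ->
  P.-integrable setT h ->
  {ae P, forall x, forall z, (g z)%:E <= h x + ((x - z) ^+ 2 / (2 * t))%:E} ->
  \int[P]_x (expR (g x))%:E <= (expR (fine (\int[P]_x h x)))%:E.
Proof.
move=> t0 cg hi gh.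
pose I (i : nat) : set (measurableTypeR R) :=
  `[(m - i.+1%:R)%R, (m + i.+1%:R)%R]%classic.
have mI i : measurable (I i) by exact: measurable_itv.
have [mh _] := integrableP _ _ _ hi.
have meg : measurable_fun [set: R] (fun x => (expR (g x))%:E).
  apply/measurable_EFinP; apply: measurableT_comp => //.
  exact: continuous_measurable_fun.
have cvgZ := @ge0_cvg_integral_itv_center P m _ meg
  (fun x => ltac:(by rewrite lee_fin expR_ge0)).
have cvgK : P (I i) @[i --> \oo] --> 1.
  have := @ge0_cvg_integral_itv_center P m (cst 1) (measurable_cst _)
    (fun=> lee01).
  have -> : \int[P]_x cst 1 x = 1.
    by rewrite integral_cst//= mul1e; exact: probability_setT.
  apply: cvg_trans; apply: near_eq_cvg; apply: nearW => i.
  by rewrite integral_cst//= mul1e.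
have cvgH : \int[P]_(x in I i) h x @[i --> \oo] --> \int[P]_x h x.
  rewrite integralE; under eq_fun do rewrite integralE.
  apply: cvgeB.
  - apply: fin_num_adde_defr; exact: (integrable_pos_fin_num measurableT hi).
  - by apply: ge0_cvg_integral_itv_center => //; exact: measurable_funepos.
  - by apply: ge0_cvg_integral_itv_center => //; exact: measurable_funeneg.
have Hfin : \int[P]_x h x \is a fin_num by exact: integrable_fin_num.
apply: cvge_le cvgZ; apply: nearW => i.
have i0 j : (0 < j.+1%:R :> R)%R by rewrite ltr0n.
have [Z Z0 [ZE _]] := normal_dual_talagrand_segment t0 (i0 i) cg hi gh.
rewrite ZE lee_fin -[Z]lnK ?posrE// ler_expR -lee_fin fineK//.
(* Two limits: [Z] is the integral over the fixed segment [I i], and [j] grows first. Thus [ln] is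
   never applied to the full integral of [expR g], whose finiteness is part of the conclusion. *)
have cK : P (I j) * (ln Z)%:E @[j --> \oo] --> (ln Z)%:E.
  by rewrite -[X in _ --> X]mul1e; apply: cvgeZr.
have -> : (ln Z)%:E = limn (fun j => P (I j) * (ln Z)%:E).
  by apply/esym/cvg_lim.
have -> : \int[P]_x h x = limn (fun j => \int[P]_(x in I j) h x).
  by apply/esym/cvg_lim.
apply: lee_lim; [exact: cvgP cK|exact: cvgP cvgH|].
exists i => // j /= ij.
have [Z' Z'0 [Z'E]] := normal_dual_talagrand_segment t0 (i0 j) cg hi gh.
apply: le_trans; apply: lee_wpmul2l => //.
rewrite lee_fin ler_ln ?posrE// -lee_fin -ZE -Z'E.
apply: ge0_subset_integral => //.
- exact: measurable_funS meg.
- by apply/subsetPset; apply: nondecreasing_itv_center.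
Qed.

End normal_dual_talagrand.

Section row_cons_continuous.
Context (R : realType).

Lemma continuous_row_cons_r n (a : R) :
  continuous (fun b : 'rV[R]_n => row_cons (a, b)).
Proof.
move=> b; have Fb : Filter (nbhs b) by exact: nbhs_filter.
apply/(@cvg_ballP _ _ _ (nbhs b) Fb) => e e0.
apply: (@filterS _ (nbhs b) Fb _ _ _ (nbhsx_ballx b e e0)) => b' [_ bb'].
split=> // i j; rewrite ord1; case: (unliftP ord0 j) => [k|] ->.
  by rewrite !row_consS.
by rewrite !row_cons0; exact: ballxx.
Qed.

Lemma continuous_row_cons_l n (b : 'rV[R]_n) :
  continuous (fun a : R => row_cons (a, b)).
Proof.
move=> a; have Fa : Filter (nbhs a) by exact: nbhs_filter.
apply/(@cvg_ballP _ _ _ (nbhs a) Fa) => e e0.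
apply: (@filterS _ (nbhs a) Fa _ _ _ (nbhsx_ballx a e e0)) => a' aa'.
split=> // i j; rewrite ord1; case: (unliftP ord0 j) => [k|] ->.
  by rewrite !row_consS; exact: ballxx.
by rewrite !row_cons0.
Qed.

Lemma row_consB n (a a' : R) (b b' : 'rV[R]_n) :
  row_cons (a, b) - row_cons (a', b') = row_cons (a - a', b - b').
Proof.
apply/rowP => i; case: (unliftP ord0 i) => [j|] ->;
by rewrite !mxE ?liftK ?unlift_none /= ?mxE.
Qed.

Lemma row_cons_delta0 n (a h : R) (b : 'rV[R]_n) :
  row_cons (h + a, b) = h *: delta_mx ord0 ord0 + row_cons (a, b).
Proof.
apply/rowP => i; rewrite !mxE; case: (unliftP ord0 i) => [j|] ->.
  by rewrite /= mulr0 add0r.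
by rewrite /= mulr1.
Qed.

Lemma row_cons_deltaS n (a h : R) (b : 'rV[R]_n) i :
  row_cons (a, h *: delta_mx ord0 i + b) =
  h *: delta_mx ord0 (lift ord0 i) + row_cons (a, b).
Proof.
apply/rowP => j; rewrite !mxE; case: (unliftP ord0 j) => [k|] ->.
  by rewrite /= !mxE (inj_eq (lift_inj (h := ord0))).
by rewrite /= mulr0 add0r.
Qed.

Lemma is_derive_row_cons_l n (f : 'rV[R]_n.+1 -> R) (a l : R) (b : 'rV[R]_n) :
  is_derive (row_cons (a, b)) (delta_mx ord0 ord0) f l ->
  is_derive a 1 (fun a => f (row_cons (a, b))) l.
Proof.
have E : (fun h => h^-1 *: ((f \o shift (row_cons (a, b)))
      (h *: delta_mx ord0 ord0) - f (row_cons (a, b)))) =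
    (fun h => h^-1 *: (((fun a => f (row_cons (a, b))) \o shift a) (h *: 1)
      - f (row_cons (a, b)))).
  by apply/funext => h /=; rewrite [h *: (1 : R)]mulr1 row_cons_delta0.
by move=> [d <-]; apply: DeriveDef; rewrite /derivable /derive -E.
Qed.

Lemma is_derive_row_cons_r n (f : 'rV[R]_n.+1 -> R) (a l : R) (b : 'rV[R]_n) i :
  is_derive (row_cons (a, b)) (delta_mx ord0 (lift ord0 i)) f l ->
  is_derive b (delta_mx ord0 i) (fun b => f (row_cons (a, b))) l.
Proof.
have E : (fun h => h^-1 *: ((f \o shift (row_cons (a, b)))
      (h *: delta_mx ord0 (lift ord0 i)) - f (row_cons (a, b)))) =
    (fun h => h^-1 *: (((fun b => f (row_cons (a, b))) \o shift b)
      (h *: delta_mx ord0 i) - f (row_cons (a, b)))).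
  by apply/funext => h /=; rewrite row_cons_deltaS.
by move=> [d <-]; apply: DeriveDef; rewrite /derivable /derive -E.
Qed.

End row_cons_continuous.

Section gaussian_dual_talagrand.
Context (R : realType).
Implicit Types (t A c : R).
Local Open Scope ereal_scope.

Lemma integral_expR_gt0 d (T : measurableType d) (P : probability T R)
    (f : T -> R) : measurable_fun setT f ->
  0 < \int[P]_x (expR (f x))%:E.
Proof.
move=> mf; rewrite lt_neqAle; apply/andP; split; last first.
  by apply: integral_ge0 => x _; rewrite lee_fin expR_ge0.
apply/eqP => e.
have mef : measurable_fun setT (fun x => (expR (f x))%:E).
  by apply/measurable_EFinP; exact: measurableT_comp.
have /(ae_eq_integral_abs P measurableT mef) : \int[P]_x `|(expR (f x))%:E| = 0.
  rewrite [RHS]e; apply: eq_integral => x _.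
  by rewrite gee0_abs// lee_fin expR_ge0.
move=> [N [mN N0 sN]].
have : P setT <= P N.
  apply: le_measure; rewrite ?inE// => x _; apply: sN => /= /(_ I) [] h.
  by have := expR_gt0 (f x); rewrite h ltxx.
by rewrite N0 probability_setT; apply/negP; rewrite -ltNge lte01.
Qed.

Lemma integrable_expR_gaussian n (y : 'rV[R]_n) t A c (g : 'rV[R]_n -> R) :
  (0 < t)%R -> (c < 1 / (2 * t))%R -> continuous g ->
  (forall x, g x <= A + c * sqnorm2 x)%R ->
  (gaussian y t).-integrable setT (fun x => (expR (g x))%:E).
Proof.
move=> t0 ct cg gA.
apply: le_integrable (integrable_expR_sqnorm2 y (expR A) t0 ct) => //.
  apply/measurable_EFinP; apply: measurableT_comp => //.
  exact: continuous_measurable_rV.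
move=> x _ /=; rewrite lee_fin ger0_norm ?expR_ge0//.
by rewrite ger0_norm ?mulr_ge0 ?expR_ge0// -expRD ler_expR.
Qed.

(** The cost is a sum over the coordinates, so the inequality can be applied to fibres first and
    then to the first coordinate. The quadratic bound on [g] keeps the fibre integrals of [expR g]
    finite and continuous. *)
Lemma gaussian_dual_talagrand n (y : 'rV[R]_n) t A c (g : 'rV[R]_n -> R)
    (h : 'rV[R]_n -> \bar R) :
  (0 < t)%R -> (0 <= c)%R -> (c < 1 / (2 * t))%R -> continuous g ->
  (forall x, g x <= A + c * sqnorm2 x)%R ->
  (gaussian y t).-integrable setT h ->
  (forall x z, (g z)%:E <= h x + (sqnorm2 (x - z) / (2 * t))%:E) ->
  \int[gaussian y t]_x (expR (g x))%:E <=
    (expR (fine (\int[gaussian y t]_x h x)))%:E.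
Proof.
move=> t0 c0 ct; elim: n y A g h => [|n IH] y A g h cg gA hi gh.
  have [mh _] := integrableP _ _ _ hi.
  have meg : measurable_fun [set: 'rV[R]_0] (fun x => (expR (g x))%:E).
    apply/measurable_EFinP; apply: measurableT_comp => //.
    exact: continuous_measurable_rV.
  rewrite /= !integral_dirac// !diracT !mul1e.
  have := gh y y; rewrite /sqnorm2 big_ord0 mul0r adde0.
  have : h y \is a fin_num.
    have := integrable_fin_num measurableT hi.
    by rewrite integral_dirac// diracT mul1e.
  by move=> hy; rewrite -{1}(fineK hy) !lee_fin ler_expR.
pose P := normal_prob (y ord0 ord0) (Num.sqrt t).
pose Q := gaussian (rV_behead y) t.
have [mh _] := integrableP _ _ _ hi.
have mg : measurable_fun [set: 'rV[R]_n.+1] g by exact: continuous_measurable_rV.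
have cga a : continuous (fun b : 'rV[R]_n => g (row_cons (a, b))).
  move=> b; apply: continuous_comp; first exact: continuous_row_cons_r.
  exact: cg.
have gAa a b : (g (row_cons (a, b)) <= (A + c * a ^+ 2) + c * sqnorm2 b)%R.
  by have := gA (row_cons (a, b)); rewrite sqnorm2_row_cons mulrDr addrA.
have ei a : Q.-integrable setT (fun b => (expR (g (row_cons (a, b))))%:E).
  exact: integrable_expR_gaussian (cga a) (gAa a).
pose S a := (\int[Q]_b expR (g (row_cons (a, b))))%R.
have SE a : \int[Q]_b (expR (g (row_cons (a, b))))%:E = (S a)%:E.
  by rewrite /S /Rintegral fineK//; apply: integrable_fin_num.
have S0 a : (0 < S a)%R.
  by rewrite -lte_fin -SE integral_expR_gt0//; exact: continuous_measurable_rV.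
have cS : continuous S.
  move=> a.
  (* Bounds [x ^+ 2] for [x] within distance 1 of [a], which gives a dominating function independent
     of [x]. *)
  pose K := ((`|a| + 1) ^+ 2)%R.
  have := @continuity_under_integral R _ _ Q (fun a b => expR (g (row_cons (a, b))))
    setT measurableT (a - 1)%R (a + 1)%R (fun x _ => ei x) _
    (fun b => expR (A + c * K) * expR (c * sqnorm2 b))%R _ _.
  move=> H; apply: H.
  - apply: aeW => b _ x _; apply: continuous_comp; last exact: continuous_expR.
    by apply: continuous_comp; [exact: continuous_row_cons_l|exact: cg].
  - exact: integrable_expR_sqnorm2.
  - move=> x; rewrite /= in_itv/= => /andP[ax xa]; apply: aeW => b _.
    rewrite ger0_norm ?expR_ge0// -expRD ler_expR.
    apply: le_trans (gAa x b) _; rewrite lerD2r lerD2l ler_wpM2l//.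
    rewrite /K -[leLHS]real_normK ?num_real// lerXn2r ?nnegrE ?addr_ge0//.
    have : (- `|a| <= a <= `|a|)%R by rewrite -ler_norml.
    rewrite ler_norml; move: `|a|%R => u /andP[h1 h2].
    by apply/andP; split; lra.
  - by rewrite inE/= in_itv/=; lra.
have hPQ := integrable_gaussianS hi.
have hae := ae_integrable1 hPQ.
rewrite ge0_integral_gaussianS; first last.
- by move=> x; rewrite lee_fin expR_ge0.
- by apply/measurable_EFinP; exact: measurableT_comp.
rewrite (integral_gaussianS hi).
under eq_integral do rewrite SE -[S _]lnK ?posrE//.
(* By [IH] on the fibres, [ln S] and the fibre integrals of [h] satisfy the
   one-dimensional cost inequality. *)
apply: normal_dual_talagrand => //.
- move=> a; apply: continuous_comp; first exact: cS.
  exact: continuous_ln.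
- exact: (integrable_fubini_F hPQ).
move: hae => [N [mN N0 sN]]; exists N; split => // a /= na; apply: sN => /= hia.
apply: na => z; rewrite -/Q.
have Ffin : \int[Q]_b h (row_cons (a, b)) \is a fin_num.
  exact: integrable_fin_num hia.
(* [IH] compares fibres over two different points, that of [g] over [z] and that of [h] over [a];
   the constant [k] added to [h] pays for moving [a] to [z]. *)
pose k := ((a - z) ^+ 2 / (2 * t))%R.
have ki : Q.-integrable setT (fun=> k%:E) by exact: finite_measure_integrable_cst.
have := IH (rV_behead y) (A + c * z ^+ 2)%R _
  (fun b => h (row_cons (a, b)) + k%:E) (cga z) (gAa z) (integrableD _ hia ki) _.
rewrite integralD// integral_cst//= probability_setT mule1 SE -/Q.
rewrite -[X in X + _]fineK// -EFinD lee_fin /= => H.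
rewrite lee_fin -ler_expR lnK ?posrE//; apply: H => // b b'.
have := gh (row_cons (a, b)) (row_cons (z, b')).
rewrite row_consB.
by rewrite sqnorm2_row_cons mulrDl EFinD addeA.
Qed.

End gaussian_dual_talagrand.

(** * Tensorization of the Poincare inequality *)

Lemma integral_cst_probability d (T : measurableType d) (R : realType)
    (P : probability T R) (c : \bar R) : (\int[P]_(x in setT) c = c)%E.
Proof.
rewrite -[RHS]mule1; apply: etrans (integral_cst P measurableT c) _.
by congr (_ * _)%E; exact: probability_setT.
Qed.

Section ge0_product_integrals.
Local Open Scope ereal_scope.
Context d1 d2 (T1 : measurableType d1) (T2 : measurableType d2) (R : realType).
Variables (P : probability T1 R) (Q : probability T2 R).

Lemma ge0_integral_product_fst (f : T1 -> \bar R) :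
  measurable_fun [set: T1] f -> (forall x, 0 <= f x) ->
  \int[P \x Q]_z f z.1 = \int[P]_x f x.
Proof.
move=> mf f0.
have mf1 : measurable_fun [set: T1 * T2] (fun z => f z.1).
  by apply: measurableT_comp => //; exact: measurable_fst.
rewrite (fubini_tonelli1 _ mf1 (fun z => f0 z.1)).
apply: eq_integral => x _; rewrite /fubini_F /=.
by rewrite integral_cst_probability.
Qed.

Lemma ge0_integral_product_snd (f : T2 -> \bar R) :
  measurable_fun [set: T2] f -> (forall x, 0 <= f x) ->
  \int[P \x Q]_z f z.2 = \int[Q]_x f x.
Proof.
move=> mf f0.
have mf1 : measurable_fun [set: T1 * T2] (fun z => f z.2).
  by apply: measurableT_comp => //; exact: measurable_snd.
rewrite (fubini_tonelli1 _ mf1 (fun z => f0 z.2)).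
by rewrite /fubini_F /= integral_cst_probability.
Qed.

(** Two independent copies of a pair are regrouped by factor, so that each factor can be doubled
    separately. *)
Lemma ge0_integral_product_reorder (G : (T1 * T2) * (T1 * T2) -> \bar R) :
  measurable_fun setT G -> (forall z, 0 <= G z) ->
  \int[P \x Q]_x \int[P \x Q]_y G (x, y) =
  \int[P \x P]_w \int[Q \x Q]_z G ((w.1, z.1), (w.2, z.2)).
Proof.
move=> mG G0.
pose PQ := product_subprobability (P : subprobability _ _, Q : subprobability _ _).
pose QQ := product_subprobability (Q : subprobability _ _, Q : subprobability _ _).
pose H (u : (T1 * T1) * (T2 * T2)) : \bar R :=
  G ((u.1.1, u.2.1), (u.1.2, u.2.2)).
have m1 : measurable_fun [set: (T1 * T1) * (T2 * T2)] (fun u => u.1.1).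
  by apply: measurableT_comp => //; exact: measurable_fst.
have m2 : measurable_fun [set: (T1 * T1) * (T2 * T2)] (fun u => u.1.2).
  apply: measurableT_comp; [exact: measurable_snd|exact: measurable_fst].
have m3 : measurable_fun [set: (T1 * T1) * (T2 * T2)] (fun u => u.2.1).
  apply: measurableT_comp; [exact: measurable_fst|exact: measurable_snd].
have m4 : measurable_fun [set: (T1 * T1) * (T2 * T2)] (fun u => u.2.2).
  by apply: measurableT_comp => //; exact: measurable_snd.
have mH : measurable_fun setT H.
  apply: measurableT_comp => //.
  by apply: measurable_fun_pair; exact: measurable_fun_pair.
have mGx x : measurable_fun setT (fun y => G (x, y)).
  by apply: measurableT_comp => //; exact: pair1_measurable.
have mHw w : measurable_fun setT (fun z => H (w, z)).
  by apply: measurableT_comp => //; exact: pair1_measurable.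
have H0 z : 0 <= H z by exact: G0.
transitivity (\int[P]_a \int[Q]_b \int[P]_a' \int[Q]_b' G ((a, b), (a', b'))).
  have mF : measurable_fun setT (fun x => \int[P \x Q]_y G (x, y)).
    exact: (@measurable_fun_fubini_tonelli_F _ _ _ _ _ PQ G mG G0).
  rewrite (fubini_tonelli1 _ mF); last by move=> x; exact: integral_ge0.
  apply: eq_integral => a _; apply: eq_integral => b _.
  by rewrite (fubini_tonelli1 _ (mGx (a, b))).
transitivity (\int[P]_a \int[P]_a' \int[Q]_b \int[Q]_b' G ((a, b), (a', b'))).
  apply: eq_integral => a _.
  pose K (u : (T2 * T1) * T2) : \bar R := G ((a, u.1.1), (u.1.2, u.2)).
  have mK : measurable_fun setT K.
    apply: measurableT_comp => //; apply: measurable_fun_pair.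
      apply: measurable_fun_pair; first exact: measurable_cst.
      by apply: measurableT_comp => //; exact: measurable_fst.
    apply: measurable_fun_pair; last exact: measurable_snd.
    by apply: measurableT_comp; [exact: measurable_snd|exact: measurable_fst].
  have mK' : measurable_fun [set: T2 * T1] (fun u => \int[Q]_b' K (u, b')).
    by apply: measurable_fun_fubini_tonelli_F => // u; exact: G0.
  apply: (fubini_tonelli (fun u : T2 * T1 => \int[Q]_b' K (u, b')) mK').
  by move=> u; apply: integral_ge0 => ? _; exact: G0.
have mF : measurable_fun setT (fun w => \int[Q \x Q]_z H (w, z)).
  exact: (@measurable_fun_fubini_tonelli_F _ _ _ _ _ QQ H mH H0).
rewrite (fubini_tonelli1 _ mF); last by move=> x; exact: integral_ge0.
apply: eq_integral => a _; apply: eq_integral => a' _.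
by rewrite (fubini_tonelli1 _ (mHw (a, a'))).
Qed.

End ge0_product_integrals.

Section poincare_tensor.
Local Open Scope ereal_scope.
Context d1 d2 (T1 : measurableType d1) (T2 : measurableType d2) (R : realType).
Variables (P : probability T1 R) (Q : probability T2 R).

Lemma measurable_sqr_diff d (T : measurableType d) (u v : T -> R) :
  measurable_fun setT u -> measurable_fun setT v ->
  measurable_fun setT (fun x => ((u x - v x) ^+ 2)%:E).
Proof.
move=> mu mv; apply/measurable_EFinP; apply: measurable_funX.
exact: measurable_funB.
Qed.

(** In a quadrilateral the squared diagonals add up to at most the squared sides; here the vertices
    are [u z.1], [u z.2], [v z.2], [v z.1]. Swapping [z.1] and [z.2] shows that both diagonals have
    the same integral, whence the factor 2. *)
Lemma sqr_diff_cross_le (u v : T2 -> R) :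
  measurable_fun [set: T2] u -> measurable_fun [set: T2] v ->
  2%:E * \int[Q \x Q]_z ((u z.1 - v z.2) ^+ 2)%:E <=
  \int[Q \x Q]_z ((u z.1 - u z.2) ^+ 2)%:E +
  \int[Q \x Q]_z ((v z.1 - v z.2) ^+ 2)%:E +
  2%:E * \int[Q]_b ((u b - v b) ^+ 2)%:E.
Proof.
move=> mu mv.
have sq0 (a : R) : 0 <= (a ^+ 2)%:E by rewrite lee_fin sqr_ge0.
have mu1 : measurable_fun [set: T2 * T2] (fun z => u z.1).
  by apply: measurableT_comp => //; exact: measurable_fst.
have mu2 : measurable_fun [set: T2 * T2] (fun z => u z.2).
  by apply: measurableT_comp => //; exact: measurable_snd.
have mv1 : measurable_fun [set: T2 * T2] (fun z => v z.1).
  by apply: measurableT_comp => //; exact: measurable_fst.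
have mv2 : measurable_fun [set: T2 * T2] (fun z => v z.2).
  by apply: measurableT_comp => //; exact: measurable_snd.
have m12 := measurable_sqr_diff mu1 mv2.
have m21 := measurable_sqr_diff mu2 mv1.
have muu := measurable_sqr_diff mu1 mu2.
have mvv := measurable_sqr_diff mv1 mv2.
have m11 := measurable_sqr_diff mu1 mv1.
have m22 := measurable_sqr_diff mu2 mv2.
have swap : \int[Q \x Q]_z ((u z.1 - v z.2) ^+ 2)%:E =
    \int[Q \x Q]_z ((u z.2 - v z.1) ^+ 2)%:E.
  by rewrite (fubini_tonelli1 _ m12)// (fubini_tonelli2 _ m21).
have -> : 2%:E = 1 + 1 :> \bar R by rewrite -EFinD.
rewrite !ge0_muleDl// !mul1e {2}swap.
rewrite -{1}(ge0_integral_product_fst Q Q (measurable_sqr_diff mu mv))//.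
rewrite -(ge0_integral_product_snd Q Q (measurable_sqr_diff mu mv))//.
rewrite -!ge0_integralD//; first last.
- exact: emeasurable_funD.
- by move=> z _; rewrite -EFinD lee_fin addr_ge0 ?sqr_ge0.
- exact: emeasurable_funD.
- by move=> z _; rewrite -EFinD lee_fin addr_ge0 ?sqr_ge0.
apply: ge0_le_integral => //.
- by move=> z _; rewrite -EFinD lee_fin addr_ge0 ?sqr_ge0.
- exact: emeasurable_funD.
- by apply: emeasurable_funD; exact: emeasurable_funD.
- move=> z _; rewrite -!EFinD lee_fin -subr_ge0.
  set d := (X in (0 <= X)%R).
  have -> : d = ((u z.1 - u z.2 - (v z.1 - v z.2)) ^+ 2)%R by rewrite /d; ring.
  exact: sqr_ge0.
Qed.

(** Subadditivity of the variance over independent factors (Efron-Stein), with each variance doubled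
    into an integral over two copies. *)
Lemma sqr_diff_tensor (f : T1 * T2 -> R) : measurable_fun setT f ->
  \int[P \x Q]_x \int[P \x Q]_y ((f x - f y) ^+ 2)%:E <=
  \int[P]_a \int[Q \x Q]_z ((f (a, z.1) - f (a, z.2)) ^+ 2)%:E +
  \int[Q]_b \int[P \x P]_w ((f (w.1, b) - f (w.2, b)) ^+ 2)%:E.
Proof.
move=> mf.
have sq0 (a : R) : 0 <= (a ^+ 2)%:E by rewrite lee_fin sqr_ge0.
pose PP := product_subprobability (P : subprobability _ _, P : subprobability _ _).
pose QQ := product_subprobability (Q : subprobability _ _, Q : subprobability _ _).
pose G (u : (T1 * T2) * (T1 * T2)) : \bar R := ((f u.1 - f u.2) ^+ 2)%:E.
have mG : measurable_fun setT G.
  apply: measurable_sqr_diff; apply: measurableT_comp => //.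
rewrite (ge0_integral_product_reorder P Q mG); last by move=> z; exact: sq0.
pose V a := \int[Q \x Q]_z ((f (a, z.1) - f (a, z.2)) ^+ 2)%:E.
pose W (w : T1 * T1) := \int[Q]_b ((f (w.1, b) - f (w.2, b)) ^+ 2)%:E.
have mV : measurable_fun setT V.
  pose V' (u : T1 * (T2 * T2)) : \bar R :=
    ((f (u.1, u.2.1) - f (u.1, u.2.2)) ^+ 2)%:E.
  apply: (@measurable_fun_fubini_tonelli_F _ _ _ _ _ QQ V') => [|z]; last exact: sq0.
  apply: measurable_sqr_diff; apply: measurableT_comp => //;
  apply: measurable_fun_pair => //; apply: measurableT_comp => //.
pose W' (u : (T1 * T1) * T2) : \bar R :=
    ((f (u.1.1, u.2) - f (u.1.2, u.2)) ^+ 2)%:E.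
have mW' : measurable_fun setT W'.
  apply: measurable_sqr_diff; apply: measurableT_comp => //;
  apply: measurable_fun_pair => //; apply: measurableT_comp => //.
have mW : measurable_fun setT W.
  by apply: (measurable_fun_fubini_tonelli_F W') => // z; exact: sq0.
have V0 a : 0 <= V a by exact: integral_ge0.
have W0 a : 0 <= W a by exact: integral_ge0.
have -> : \int[Q]_b \int[P \x P]_w ((f (w.1, b) - f (w.2, b)) ^+ 2)%:E =
    \int[P \x P]_w W w.
  by apply/esym; apply: (@fubini_tonelli _ _ _ _ _ PP Q W') => // z; exact: sq0.
have two : 2%:E = 1 + 1 :> \bar R by rewrite -EFinD.
have mA : measurable_fun [set: T1 * T1] (fun w =>
    \int[Q \x Q]_z ((f (w.1, z.1) - f (w.2, z.2)) ^+ 2)%:E).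
  pose A' (u : (T1 * T1) * (T2 * T2)) : \bar R :=
    ((f (u.1.1, u.2.1) - f (u.1.2, u.2.2)) ^+ 2)%:E.
  apply: (@measurable_fun_fubini_tonelli_F _ _ _ _ _ QQ A') => [|z]; last exact: sq0.
  apply: measurable_sqr_diff; apply: measurableT_comp => //;
  apply: measurable_fun_pair => //; apply: measurableT_comp => //.
have mV1 : measurable_fun [set: T1 * T1] (fun w => V w.1).
  by apply: measurableT_comp.
have mV2 : measurable_fun [set: T1 * T1] (fun w => V w.2).
  by apply: measurableT_comp.
(* After doubling, the claim is [sqr_diff_cross_le] for [f (w.1, _)] and [f (w.2, _)], integrated
   over [w]; its first two terms both integrate to that of [V]. *)
rewrite -(@lee_pmul2l _ 2%:E)//.
have -> : 2%:E * (\int[P]_a V a + \int[P \x P]_w W w) =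
    2%:E * \int[P]_a V a + 2%:E * \int[P \x P]_w W w.
  by apply: ge0_muleDr; apply: integral_ge0.
rewrite -[leLHS]ge0_integralZl//; last first.
  by move=> w _; apply: integral_ge0 => z _; exact: sq0.
rewrite -(ge0_integralZl _ measurableT mW)//.
rewrite [in 2%:E * \int[P]_a _]two ge0_muleDl// mul1e.
rewrite -{1}(ge0_integral_product_fst P P mV)//.
rewrite -(ge0_integral_product_snd P P mV)//.
have mW2 : measurable_fun [set: T1 * T1] (fun w => 2%:E * W w).
  exact: emeasurable_funM.
rewrite -!ge0_integralD//; first last.
- by move=> w _; exact: mule_ge0.
- exact: emeasurable_funD.
- by move=> w _; exact: adde_ge0.
apply: ge0_le_integral => //.
- move=> w _; apply: mule_ge0 => //.
  by apply: integral_ge0 => z _; exact: sq0.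
- exact: emeasurable_funM.
- by apply: emeasurable_funD => //; exact: emeasurable_funD.
- move=> w _; apply: sqr_diff_cross_le; apply: measurableT_comp => //;
  exact: pair1_measurable.
Qed.

End poincare_tensor.

Section mean_zero.
Local Open Scope ereal_scope.
Context d (T : measurableType d) (R : realType) (P : probability T R).

(** Expanding the square, the cross term integrates to zero. The integral of [f ^+ 2] may be
    infinite. *)
Lemma mean0_sqr_le (f : T -> R) : P.-integrable setT (EFin \o f) ->
  \int[P]_x (f x)%:E = 0 ->
  2%:E * \int[P]_x (f x ^+ 2)%:E <=
  \int[P]_x \int[P]_y ((f x - f y) ^+ 2)%:E.
Proof.
move=> fi f0; have [mf _] := integrableP _ _ _ fi.
have {}mf : measurable_fun setT f by apply/measurable_EFinP.
have sq0 (a : R) : 0 <= (a ^+ 2)%:E by rewrite lee_fin sqr_ge0.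
have msq : measurable_fun setT (fun x => (f x ^+ 2)%:E).
  by apply/measurable_EFinP; exact: measurable_funX.
have H c : (c ^+ 2)%:E + \int[P]_y (f y ^+ 2)%:E <=
    \int[P]_y ((c - f y) ^+ 2)%:E.
  have mc : measurable_fun setT (fun y => ((c - f y) ^+ 2)%:E).
    by apply: measurable_sqr_diff.
  (* If the right side is finite, [(c - f) ^+ 2] is integrable, and [f ^+ 2] is written as a sum of
     integrable functions. *)
  have [->|] := eqVneq (\int[P]_y ((c - f y) ^+ 2)%:E) +oo.
    by rewrite leey.
  rewrite -ltey => fin.
  have ic : P.-integrable setT (fun y => ((c - f y) ^+ 2)%:E).
    apply/integrableP; split => //.
    by under eq_integral do rewrite gee0_abs//.
  have icf : P.-integrable setT (fun y => (2 * c)%:E * (f y)%:E).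
    exact: integrableZl.
  have icc : P.-integrable setT (fun y => (c ^+ 2)%:E).
    exact: finite_measure_integrable_cst.
  have -> : \int[P]_y (f y ^+ 2)%:E = \int[P]_y
      (((c - f y) ^+ 2)%:E + ((2 * c)%:E * (f y)%:E - (c ^+ 2)%:E)).
    apply: eq_integral => x _; rewrite -EFinM -EFinB -EFinD; congr EFin; ring.
  rewrite integralD//; last exact: integrableB.
  rewrite integralB// integralZl// f0 mule0 sub0e.
  rewrite integral_cst_probability addeCA subee// adde0//.
rewrite (_ : 2%:E = 1 + 1); last by rewrite -EFinD.
rewrite ge0_muleDl// mul1e.
rewrite -{2}(integral_cst_probability P (\int[P]_x (f x ^+ 2)%:E)).
rewrite -ge0_integralD//.
- apply: ge0_le_integral => //.
  + by move=> x _; apply: adde_ge0 => //; exact: integral_ge0.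
  + exact: emeasurable_funD.
  + apply: (measurable_fun_fubini_tonelli_F (m2 := P)
      (fun u : T * T => ((f u.1 - f u.2) ^+ 2)%:E)) => //.
    by apply: measurable_sqr_diff; apply: measurableT_comp.
- by move=> x _; exact: integral_ge0.
Qed.

End mean_zero.

Section gaussian_poincare.
Local Open Scope ereal_scope.
Context (R : realType).

(** [sqr_diff_tensor] splits off the first coordinate: the inequality on the line treats the fibres
    in that coordinate, the induction hypothesis the others. *)
Lemma gaussian_poincare n (y : 'rV[R]_n) (t : R) (f : 'rV[R]_n -> R)
    (D : 'I_n -> 'rV[R]_n -> R) : (0 < t)%R -> continuous f ->
  (forall i, continuous (D i)) ->
  (forall i x, is_derive x (delta_mx ord0 i) f (D i x)) ->
  \int[gaussian y t]_x \int[gaussian y t]_x' ((f x - f x') ^+ 2)%:E <=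
  (2 * t)%:E * \sum_(i < n) \int[gaussian y t]_x (D i x ^+ 2)%:E.
Proof.
move=> t0; elim: n y f D => [|n IH] y f D cf cD dD.
  rewrite big_ord0 mule0 le_eqVlt; apply/predU1P; left.
  apply: integral0_eq => x _; apply: integral0_eq => x' _.
  have -> : x = x' by apply/rowP => -[].
  by rewrite subrr expr0n.
pose P := normal_prob (y ord0 ord0) (Num.sqrt t).
pose Q := gaussian (rV_behead y) t.
have sq0 (a : R) : 0 <= (a ^+ 2)%:E by rewrite lee_fin sqr_ge0.
have mf : measurable_fun [set: 'rV[R]_n.+1] f by exact: continuous_measurable_rV.
have mD i : measurable_fun [set: 'rV[R]_n.+1] (fun x => (D i x ^+ 2)%:E).
  apply/measurable_EFinP; apply: measurable_funX.
  exact: continuous_measurable_rV.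
pose F u := f (@row_cons R n u).
have mF : measurable_fun setT F.
  by apply: measurableT_comp => //; exact: measurable_row_cons.
have -> : \int[gaussian y t]_x \int[gaussian y t]_x' ((f x - f x') ^+ 2)%:E =
    \int[(P \x Q)%E]_u \int[(P \x Q)%E]_v ((F u - F v) ^+ 2)%:E.
  have E x : \int[gaussian y t]_x' ((f x - f x') ^+ 2)%:E =
      \int[(P \x Q)%E]_v ((f x - F v) ^+ 2)%:E.
    rewrite /= ge0_integral_pushforward ?preimage_setT//.
    by apply: measurable_sqr_diff.
  under eq_integral do rewrite E.
  rewrite /= ge0_integral_pushforward ?preimage_setT//.
  - rewrite -(_ : (fun x => \int[gaussian y t]_x' ((f x - f x') ^+ 2)%:E) =
      (fun x => \int[(P \x Q)%E]_v ((f x - F v) ^+ 2)%:E)); last exact/funext.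
    apply: (measurable_fun_fubini_tonelli_F (m2 := gaussian y t)
      (fun u : 'rV[R]_n.+1 * 'rV[R]_n.+1 => ((f u.1 - f u.2) ^+ 2)%:E)) => //.
    by apply: measurable_sqr_diff; apply: measurableT_comp.
  - by move=> x _; exact: integral_ge0.
apply: le_trans (sqr_diff_tensor P Q mF) _.
rewrite big_ord_recl ge0_muleDr; last 2 first.
- by apply: integral_ge0 => x _; exact: sq0.
- by apply: sume_ge0 => i _; apply: integral_ge0 => x _; exact: sq0.
have t20 : 0 <= (2 * t)%:E by rewrite lee_fin mulr_ge0// ltW.
have mDr i : measurable_fun [set: measurableTypeR R * 'rV[R]_n]
    (fun u => (D i (row_cons u) ^+ 2)%:E).
  apply: (@measurableT_comp _ _ _ _ _ _ _ _ (@row_cons R n) (mD i)).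
  exact: measurable_row_cons.
have mFa a : measurable_fun setT (fun b => F (a, b)).
  by apply: measurableT_comp => //; exact: pair1_measurable.
have mFb b : measurable_fun setT (fun a => F (a, b)).
  by apply: measurableT_comp => //; exact: pair2_measurable.
have fstT d1 d2 (T1 : measurableType d1) (T2 : measurableType d2) :
  measurable_fun [set: T1 * T2] fst by exact: measurable_fst.
pose QQ := product_subprobability (Q : subprobability _ _, Q : subprobability _ _).
pose PP := product_subprobability (P : subprobability _ _, P : subprobability _ _).
rewrite addeC; apply: leeD.
- pose H u := ((F (u.1.1, u.2) - F (u.1.2, u.2)) ^+ 2)%:E.
  have mH : measurable_fun setT H.
    apply: measurable_sqr_diff; apply: measurableT_comp => //;
    apply: measurable_fun_pair => //; apply: measurableT_comp => //.
  rewrite (ge0_integral_gaussianS _ _ (mD ord0))//.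
  rewrite (fubini_tonelli (fun u => (D ord0 (row_cons u) ^+ 2)%:E) (mDr ord0))//.
  have mG0 := @measurable_fun_fubini_tonelli_G _ _ _ _ _ P _ (mDr ord0)
    (fun u => sq0 _).
  rewrite -ge0_integralZl//; last first.
    by move=> x _; apply: integral_ge0 => a _; exact: sq0.
  apply: ge0_le_integral => //.
  + by move=> b _; apply: integral_ge0 => w _; exact: sq0.
  + apply: (@measurable_fun_fubini_tonelli_G _ _ _ _ _ PP H) => // u; exact: sq0.
  + exact: emeasurable_funM.
  + move=> b _.
    have mFw : measurable_fun setT (fun w : measurableTypeR R * measurableTypeR R =>
        ((F (w.1, b) - F (w.2, b)) ^+ 2)%:E).
      by apply: measurable_sqr_diff; apply: (measurableT_comp (mFb b)).
    rewrite (fubini_tonelli1 _ mFw)//.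
    apply: (@normal_poincare R (y ord0 ord0) t (fun a => F (a, b))
      (fun a => D ord0 (row_cons (a, b))) t0).
      by move=> a; apply: is_derive_row_cons_l; exact: dD.
    move=> a; apply: continuous_comp; first exact: continuous_row_cons_l.
    exact: cD.
- pose H u := ((F (u.1, u.2.1) - F (u.1, u.2.2)) ^+ 2)%:E.
  have mH : measurable_fun setT H.
    apply: measurable_sqr_diff; apply: measurableT_comp => //;
    apply: measurable_fun_pair => //; apply: measurableT_comp => //.
  have mDi i := @measurable_integral_row_cons R n Q _ (mD (lift ord0 i))
    (fun u => sq0 _).
  have D0 i a : 0 <= \int[Q]_b (D (lift ord0 i) (row_cons (a, b)) ^+ 2)%:E.
    by apply: integral_ge0 => b _; exact: sq0.
  rewrite (eq_bigr (fun i : 'I_n => \int[P]_a \int[Q]_b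
      (D (lift ord0 i) (row_cons (a, b)) ^+ 2)%:E)); last first.
    by move=> i _; rewrite ge0_integral_gaussianS.
  rewrite -ge0_integral_sum//.
  have mS : measurable_fun [set: R] (fun a => \sum_(i < n)
      \int[Q]_b (D (lift ord0 i) (row_cons (a, b)) ^+ 2)%:E).
    exact: emeasurable_sum.
  rewrite -ge0_integralZl//; last by move=> a _; exact: sume_ge0.
  apply: ge0_le_integral => //.
  + by move=> b _; apply: integral_ge0 => w _; exact: sq0.
  + apply: (@measurable_fun_fubini_tonelli_F _ _ _ _ _ QQ H) => // u; exact: sq0.
  + exact: emeasurable_funM.
  + move=> a _.
    have mFw : measurable_fun setT (fun w : 'rV[R]_n * 'rV[R]_n =>
        ((F (a, w.1) - F (a, w.2)) ^+ 2)%:E).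
      by apply: measurable_sqr_diff; apply: (measurableT_comp (mFa a)).
    rewrite (fubini_tonelli1 _ mFw)//.
    apply: (IH (rV_behead y) (fun b => F (a, b))
      (fun i b => D (lift ord0 i) (row_cons (a, b)))).
    * by move=> b; apply: (continuous_comp (@continuous_row_cons_r R n a b) (cf _)).
    * move=> i b.
      by apply: (continuous_comp (@continuous_row_cons_r R n a b) (cD _ _)).
    * by move=> i b; apply: is_derive_row_cons_r; exact: dD.
Qed.

End gaussian_poincare.

(** * Concave functions and Gaussian means *)

Section concave_gradient.
Context (R : realType) (n : nat) (f : 'rV[R]_n -> R).
Hypothesis f_concave : concave_function f.

Lemma concave_function_le (x y : 'rV[R]_n) (s : R) : 0 <= s -> s <= 1 ->
  s * f x + (1 - s) * f y <= f (s *: x + (1 - s) *: y).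
Proof.
move=> s0 s1.
have s01 : Itv.spec (@Itv.num_sem R) (Itv.Real `[0%Z, 1%Z]%O) s.
  by apply/and3P; split; rewrite ?num_real// in_itv/= s0.
have := @f_concave (Itv.mk s01) x y; rewrite !inE => /(_ I I).
move=> H; rewrite -lerN2 opprD -!mulrN; exact: H.
Qed.

(** Used to decompose a displacement into displacements along the coordinate axes, with equal
    weights. *)
Lemma concave_function_jensen (k : nat) (x : 'I_k.+1 -> 'rV[R]_n) :
  k.+1%:R^-1 * (\sum_i f (x i)) <= f (k.+1%:R^-1 *: \sum_i x i).
Proof.
elim: k x => [|k IH] x; first by rewrite invr1 !big_ord1 mul1r scale1r.
pose s : R := k.+1%:R / k.+2%:R.
have k1 : k.+1%:R != 0 :> R by rewrite pnatr_eq0.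
have k2 : k.+2%:R != 0 :> R by rewrite pnatr_eq0.
have s0 : 0 <= s by rewrite divr_ge0.
have s1 : s <= 1 by rewrite ler_pdivrMr ?ltr0n// mul1r ler_nat.
have e1 : k.+2%:R^-1 = s * k.+1%:R^-1 :> R by rewrite /s mulrAC divff ?mul1r.
have e2 : k.+2%:R^-1 = 1 - s :> R.
  apply: (mulIf k2); rewrite mulVf// mulrBl divfK// mul1r.
  by rewrite -[k.+2%:R]natr1 addrAC subrr add0r.
pose x' i := x (widen_ord (leqnSn k.+1) i).
pose z := k.+1%:R^-1 *: \sum_i x' i.
have -> : k.+2%:R^-1 *: \sum_i x i = s *: z + (1 - s) *: x ord_max.
  by rewrite big_ord_recr /= scalerDr {2}e2 e1 -scalerA.
apply: le_trans (concave_function_le z (x ord_max) s0 s1).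
rewrite big_ord_recr /= mulrDr {2}e2 e1 -mulrA lerD2r.
by apply: ler_wpM2l => //; exact: IH.
Qed.

Hypothesis f_derivable : forall i x, derivable f x (delta_mx ord0 i).

Lemma is_derive0_ge0 (K : R -> R) (l : R) : is_derive (0 : R) 1 K l -> K 0 = 0 ->
  (forall s, 0 < s -> 0 <= K s) -> 0 <= l.
Proof.
move=> [dK <-] K0 Kge.
have cv : h^-1 *: ((K \o shift 0) (h *: 1) - K 0) @[h --> 0^'] --> 'D_1 K 0.
  exact: dK.
have cv' : h^-1 *: ((K \o shift 0) (h *: 1) - K 0) @[h --> 0^'+] --> 'D_1 K 0.
  exact: cvg_dnbhs_at_right cv.
rewrite -(cvg_lim _ cv')//; apply: limr_ge; first exact: cvgP cv'.
near=> h.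
have h0 : 0 < h by near: h; exact: nbhs_right_gt.
rewrite /= addr0 [h *: 1]mulr1 K0 subr0 /GRing.scale/= mulr_ge0 ?Kge//.
by rewrite invr_ge0 ltW.
Unshelve. all: by end_near.
Qed.

Lemma is_derive_line (a v : 'rV[R]_n) : derivable f a v ->
  is_derive (0 : R) 1 (fun s => f (a + s *: v)) ('D_v f a).
Proof.
have E : (fun h => h^-1 *: ((f \o shift a) (h *: v) - f a)) =
    (fun h => h^-1 *: (((fun s => f (a + s *: v)) \o shift 0) (h *: (1 : R))
      - f (a + 0 *: v))).
  apply/funext => h /=; rewrite [h *: (1 : R)]mulr1 addr0 scale0r addr0.
  by rewrite [h *: v + a]addrC.
by move=> d; apply: DeriveDef; rewrite /derivable /derive -E.
Qed.

End concave_gradient.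

Section concave_gradient_le.
Context (R : realType) (n : nat) (f : 'rV[R]_n -> R).
Hypothesis f_concave : concave_function f.
Hypothesis f_derivable : forall i x, derivable f x (delta_mx ord0 i).

(* Concavity gives [s f(a+v) <= (1+s) f a - f(a - s v)], and Jensen bounds
   [f(a - s v)] below by an average of [f] at points [a - n s v_i e_i] on the
   coordinate lines through [a]; the claim is the derivative at [s = 0]. *)
Lemma concave_gradient_le (a v : 'rV[R]_n) :
  f (a + v) <= f a + \sum_(i < n) v ord0 i * partial i f a.
Proof.
case: n f f_concave f_derivable a v => [|k] g gc gd a v.
  by rewrite big_ord0 addr0 (_ : a + v = a)//; apply/rowP => -[].
pose e i : 'rV[R]_k.+1 := delta_mx ord0 i.
pose K0 : R := k.+1%:R.
have K0n : K0 != 0 by rewrite pnatr_eq0.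
pose w i := - (K0 * v ord0 i).
pose G s := K0^-1 * \sum_i g (a + (w i * s) *: e i).
pose K s := (1 + s) * g a - G s - s * g (a + v).
have vE : v = \sum_i v ord0 i *: e i by rewrite [LHS]row_sum_delta.
have KE s : 0 < s -> 0 <= K s.
  move=> s0.
  have H1 : G s <= g (a - s *: v).
    rewrite /G; apply: le_trans (concave_function_jensen gc _) _.
    rewrite le_eqVlt; apply/predU1P; left; congr g.
    rewrite big_split/= sumr_const card_ord scalerDr -[a *+ _]scaler_nat.
    rewrite scalerA mulVf//.
    rewrite scale1r; congr (_ + _); rewrite [in RHS]vE !scaler_sumr -sumrN.
    apply: eq_bigr => i _; rewrite !scalerA -scaleNr; congr (_ *: _).
    by rewrite /w; field.
  (* The weight of [a + v] when [a] is written as a convex combination of [a + v] and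
     [a - s *: v]. *)
  pose r := s / (1 + s).
  have s1 : 1 + s != 0 by rewrite gt_eqF// addr_gt0.
  have r0 : 0 <= r by rewrite divr_ge0// ?addr_ge0// ltW.
  have r1 : r <= 1 by rewrite ler_pdivrMr ?addr_gt0// mul1r lerDr.
  have := concave_function_le gc (a + v) (a - s *: v) r0 r1.
  have -> : r *: (a + v) + (1 - r) *: (a - s *: v) = a.
    apply/rowP => i; rewrite !mxE /r; field; exact: s1.
  have -> : 1 - r = (1 + s)^-1 by rewrite /r; field.
  rewrite -(ler_pM2l (_ : 0 < 1 + s)) ?addr_gt0// mulrDr !mulrA mulfV// mul1r.
  rewrite (mulrC (1 + s) s) mulfK// => H2; rewrite /K.
  move: (G s) (g _) (g a) (g _) H1 H2 => G' p q r' H1 H2.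
  by rewrite -subr_ge0; lra.
have dG : is_derive (0 : R) 1 G (K0^-1 * \sum_i (w i * partial i g a)).
  pose h i s := g (a + (w i * s) *: e i).
  have dh i : is_derive (0 : R) 1 (h i) (w i * partial i g a).
    have d1 := is_derive_line (gd i a).
    have d2 : is_derive (0 : R) 1 (fun s => w i * s) (w i).
      by apply: is_derive_eq; rewrite /GRing.scale/=; ring.
    have d3 : is_derive (w i * 0) 1 (fun s => g (a + s *: e i)) (partial i g a).
      by rewrite mulr0.
    have := @is_derive1_comp R (fun s => g (a + s *: e i)) (fun s => w i * s)
      0 _ _ d3 d2.
    by rewrite mulrC.
  have -> : G = K0^-1 \*: (\sum_i h i).
    by apply/funext => s; rewrite /G /= fct_sumE.
  by apply: is_deriveZ; exact: is_derive_sum.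
have dK : is_derive (0 : R) 1 K
    (g a - K0^-1 * \sum_i (w i * partial i g a) - g (a + v)).
  apply: is_derive_eq; rewrite /GRing.scale/=; ring.
have K00 : K 0 = 0.
  rewrite /K /G mul0r subr0 addr0 mul1r.
  under eq_bigr do rewrite mulr0 scale0r addr0.
  by rewrite sumr_const card_ord -mulr_natl mulrA mulVf// mul1r subrr.
have := is_derive0_ge0 dK K00 KE.
have -> : K0^-1 * \sum_i (w i * partial i g a) =
    - \sum_i (v ord0 i * partial i g a).
  rewrite mulr_sumr -sumrN; apply: eq_bigr => i _.
  by rewrite /w; field.
by rewrite opprK subr_ge0.
Qed.

End concave_gradient_le.

(** * Growth at most exponential in the squared norm *)

Section exp_growth.
Context (R : realType).
Implicit Types (c t C : R).

Lemma sqnorm2_ge0 n (x : 'rV[R]_n) : 0 <= sqnorm2 x.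
Proof. by apply: sumr_ge0 => i _; exact: sqr_ge0. Qed.

(** A slightly larger rate [c'] absorbs a translation. The coefficient of [sqnorm2 v] is the one
    that makes the difference of the two sides a perfect square in each coordinate. *)
Lemma sqnorm2D_le n c c' (x v : 'rV[R]_n) : c < c' ->
  c * sqnorm2 (x + v) <=
  c' * sqnorm2 x + (c + c ^+ 2 / (c' - c)) * sqnorm2 v.
Proof.
move=> cc'; have d0 : 0 < c' - c by rewrite subr_gt0.
rewrite /sqnorm2 !mulr_sumr -big_split/=; apply: ler_sum => i _.
rewrite mxE -subr_ge0; set d := (X in 0 <= X).
have -> : d = (c' - c) * (x ord0 i - c * v ord0 i / (c' - c)) ^+ 2.
  by rewrite /d; field; rewrite gt_eqF.
by rewrite mulr_ge0 ?sqr_ge0// ltW.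
Qed.

Definition exp_growth n c (f : 'rV[R]_n -> R) :=
  exists2 C, 0 <= C & forall x, `|f x| <= C * expR (c * sqnorm2 x).

Lemma exp_growth_shift n c c' (f : 'rV[R]_n -> R) (r : R) : 0 <= c -> c < c' ->
  exp_growth c f ->
  exists2 C, 0 <= C & forall v x, sqnorm2 v <= r ->
    `|f (x + v)| <= C * expR (c' * sqnorm2 x).
Proof.
move=> c0 cc' [C C0 fC]; pose K := c + c ^+ 2 / (c' - c).
have K0 : 0 <= K by rewrite addr_ge0// divr_ge0 ?sqr_ge0// subr_ge0 ltW.
exists (C * expR (K * r)); first by rewrite mulr_ge0 ?expR_ge0.
move=> v x vr; apply: le_trans (fC _) _; rewrite -mulrA ler_wpM2l// -expRD ler_expR.
apply: le_trans (sqnorm2D_le x v cc') _.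
by rewrite addrC lerD2r ler_wpM2l.
Qed.

Lemma sqnorm2_delta n (i : 'I_n) a : sqnorm2 (a *: delta_mx ord0 i : 'rV[R]_n) = a ^+ 2.
Proof.
rewrite /sqnorm2 (bigD1 i)//= !mxE !eqxx mulr1 big1 ?addr0// => j ji.
by rewrite !mxE (negbTE ji) andbF mulr0 expr0n.
Qed.

(** By concavity the partial derivative at [x] lies between [f (x + e_i) - f x] and
    [f x - f (x - e_i)], so it inherits the growth of [f] up to unit translations. *)
Lemma exp_growth_partial n c c' (f : 'rV[R]_n -> R) (i : 'I_n) :
  concave_function f -> (forall i x, derivable f x (delta_mx ord0 i)) ->
  0 <= c -> c < c' -> exp_growth c f -> exp_growth c' (partial i f).
Proof.
move=> fc fd c0 cc' fg.
have [C C0 fC] := exp_growth_shift 1 c0 cc' fg.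
exists (3 * C); first by rewrite mulr_ge0.
move=> x; rewrite -mulrA.
have line a : f (x + a *: delta_mx ord0 i) <= f x + a * partial i f x.
  apply: le_trans (concave_gradient_le fc fd _ _) _; rewrite lerD2l.
  rewrite (bigD1 i)//= !mxE !eqxx mulr1 big1 ?addr0// => j ji.
  by rewrite !mxE (negbTE ji) andbF mulr0 mul0r.
have h0 := fC 0 x; have h1 := fC (1 *: delta_mx ord0 i) x.
have h2 := fC ((-1) *: delta_mx ord0 i) x.
move: h0 h1 h2; rewrite !sqnorm2_delta addr0 sqrrN !expr1n /sqnorm2.
rewrite [X in X <= 1 -> _]big1 => [h0 h1 h2|j _]; last by rewrite mxE expr0n.
have {h0} := h0 ler01; have {h1} := h1 (lexx _); have {h2} := h2 (lexx _).
have := line 1; have := line (-1).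
move: (C * _) (f (x + _)) (f (x + _)) (f x) (partial i f x) => E p q r d l1 l2.
rewrite !ler_norml => /andP[? ?] /andP[? ?] /andP[? ?].
by apply/andP; split; lra.
Qed.

Local Open Scope ereal_scope.

Lemma exp_growth_integrable n (y : 'rV[R]_n) t c (f : 'rV[R]_n -> R) :
  (0 < t)%R -> (c < 1 / (2 * t))%R -> continuous f -> exp_growth c f ->
  (gaussian y t).-integrable setT (EFin \o f).
Proof.
move=> t0 ct cf [C C0 fC].
apply: le_integrable (integrable_expR_sqnorm2 y C t0 ct) => //.
  by apply/measurable_EFinP; exact: continuous_measurable_rV.
move=> x _ /=; rewrite lee_fin (le_trans (fC x))// ger0_norm//.
by rewrite mulr_ge0 ?expR_ge0.
Qed.

End exp_growth.

Section gaussian_mean.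
Context (R : realType) (n : nat) (t : R).
Hypothesis t0 : 0 < t.
Implicit Types (h f : 'rV[R]_n -> R) (y : 'rV[R]_n) (c r : R).
Local Open Scope ereal_scope.

Definition gaussian_mean h y : R := fine (\int[gaussian y t]_x (h x)%:E).

Section growth.
Variables (h : 'rV[R]_n -> R) (c : R).
Hypotheses (ch : continuous h) (c0 : (0 <= c)%R) (ct : (c < 1 / (2 * t))%R).
Hypothesis hg : exp_growth c h.

Lemma gaussian_meanE y :
  \int[gaussian y t]_x (h x)%:E = (gaussian_mean h y)%:E.
Proof.
rewrite /gaussian_mean fineK//; apply: integrable_fin_num => //.
exact: exp_growth_integrable hg.
Qed.

Lemma integrable_gaussian_mean y :
  (gaussian 0 t).-integrable setT (fun x => (h (x + y)%R)%:E).
Proof.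
have mh : measurable_fun [set: 'rV[R]_n] (EFin \o h).
  by apply/measurable_EFinP; exact: continuous_measurable_rV.
apply: (integrable_gaussian_shift y t0 mh).1.
exact: exp_growth_integrable hg.
Qed.

Lemma gaussian_mean_shift y :
  (gaussian_mean h y)%:E = \int[gaussian 0 t]_x (h (x + y)%R)%:E.
Proof.
rewrite -gaussian_meanE integral_gaussian_shift//.
exact: exp_growth_integrable hg.
Qed.

Lemma gaussian_mean_bounded r :
  exists B : R, forall y, (sqnorm2 y <= r)%R -> (`|gaussian_mean h y| <= B)%R.
Proof.
(* The midpoint leaves room on both sides: above [c] for the translations, below the critical rate
   for integrability. *)
pose c' := ((c + 1 / (2 * t)) / 2)%R.
have [cc' c't] : (c < c')%R /\ (c' < 1 / (2 * t))%R by rewrite /c' !midf_lt.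
have [C C0 hC] := exp_growth_shift r c0 cc' hg.
have iE := integrable_expR_sqnorm2 (0 : 'rV[R]_n) C t0 c't.
exists (fine (\int[gaussian (0 : 'rV[R]_n) t]_x
  (C * expR (c' * sqnorm2 x))%:E)) => y yr.
rewrite -lee_fin fineK; last exact: integrable_fin_num.
rewrite -[(`|_|)%:E]/(`|(gaussian_mean h y)%:E|) gaussian_mean_shift.
have ih := integrable_gaussian_mean y.
apply: le_trans (le_abse_integral _ measurableT (measurable_int _ ih)) _.
apply: le_integral => //; first exact: integrable_abse.
by move=> x _; rewrite lee_fin; exact: hC.
Qed.

Lemma sqnorm2_line_le y (v : 'rV[R]_n) (s : R) : (`|s| <= 1)%R ->
  (sqnorm2 (y + s *: v) <= 2 * sqnorm2 y + 2 * sqnorm2 v)%R.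
Proof.
move=> s1; have s2 : (s ^+ 2 <= 1)%R by rewrite -real_normK ?num_real// expr_le1.
rewrite /sqnorm2 !mulr_sumr -big_split/=; apply: ler_sum => i _; rewrite !mxE.
move: (y ord0 i) (v ord0 i) => p q.
have : (0 <= (p - s * q) ^+ 2)%R by exact: sqr_ge0.
have : (0 <= (1 - s ^+ 2) * q ^+ 2)%R by rewrite mulr_ge0 ?sqr_ge0// subr_ge0.
nra.
Qed.

Lemma gaussian_mean_continuous_line y (v : 'rV[R]_n) :
  {for 0%R, continuous (fun s : R => gaussian_mean h (y + s *: v)%R)}.
Proof.
pose c' := ((c + 1 / (2 * t)) / 2)%R.
have [cc' c't] : (c < c')%R /\ (c' < 1 / (2 * t))%R by rewrite /c' !midf_lt.
have [C C0 hC] := exp_growth_shift (2 * sqnorm2 y + 2 * sqnorm2 v) c0 cc' hg.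
have iE := integrable_expR_sqnorm2 (0 : 'rV[R]_n) C t0 c't.
have -> : (fun s : R => gaussian_mean h (y + s *: v)%R) =
    (fun s => \int[gaussian 0 t]_x h (x + (y + s *: v)))%R.
  by apply/funext => s; rewrite /Rintegral -gaussian_mean_shift.
have := @continuity_under_integral R _ _ (gaussian 0 t)
  (fun s x => h (x + (y + s *: v)))%R setT measurableT (-1)%R 1%R
  (fun s _ => integrable_gaussian_mean _) _ _ iE.
apply.
- apply: aeW => x _ s _; apply: continuous_comp; last exact: ch.
  apply: cvgD; first exact: cvg_cst.
  apply: cvgD; first exact: cvg_cst.
  exact: scalel_continuous.
- move=> s; rewrite /= in_itv/= => /andP[s1 s2]; apply: aeW => x _.
  by apply: hC; apply: sqnorm2_line_le; rewrite ler_norml !ltW.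
- by rewrite inE/= in_itv/=; lra.
Qed.

End growth.

Section gradient.
Variables (f : 'rV[R]_n -> R) (c : R).
Hypotheses (cf : continuous f) (c0 : (0 <= c)%R) (ct : (c < 1 / (2 * t))%R).
Hypothesis fg : exp_growth c f.
Hypothesis f_concave : concave_function f.
Hypothesis f_derivable : forall i x, derivable f x (delta_mx ord0 i).
Hypothesis cdf : forall i, continuous (partial i f).

Let c' := ((c + 1 / (2 * t)) / 2)%R.
Let cc' : (c < c')%R. Proof. by rewrite /c' midf_lt. Qed.
Let c't : (c' < 1 / (2 * t))%R. Proof. by rewrite /c' midf_lt. Qed.
Let c'0 : (0 <= c')%R. Proof. exact: le_trans (ltW cc'). Qed.
Let dfg i : exp_growth c' (partial i f). Proof. exact: exp_growth_partial fg. Qed.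

(** Integrates [concave_gradient_le] at the translated points. The means of the partial derivatives
    thus form a supergradient of the mean of [f], which takes the place of differentiating under the
    integral. *)
Lemma gaussian_mean_gradient_le y y' :
  (gaussian_mean f y' <= gaussian_mean f y +
   \sum_(i < n) (y' - y)%R ord0 i * gaussian_mean (partial i f) y)%R.
Proof.
have idf i : (gaussian 0 t).-integrable setT (fun x =>
    ((y' - y)%R ord0 i)%:E * (partial i f (x + y)%R)%:E).
  have := integrable_gaussian_mean (@cdf i) c't (dfg i) y.
  exact: integrableZl.
have iS := integrable_sum (P := xpredT) measurableT (index_enum 'I_n)
  (fun i _ => idf i).
have ify := integrable_gaussian_mean cf ct fg.
rewrite -lee_fin EFinD -sumEFin.
under eq_bigr => i _.
  rewrite EFinM (gaussian_mean_shift (@cdf i) c't (dfg i)) -integralZl//; last first.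
    exact: (integrable_gaussian_mean (@cdf i) c't (dfg i)).
  over.
rewrite /= -integral_sum// !(gaussian_mean_shift cf ct fg) -integralD//.
apply: le_integral => //; first exact: integrableD.
move=> x _; rewrite /= sumEFin -EFinD lee_fin.
have -> : (x + y' = (x + y) + (y' - y))%R by rewrite -addrA [(y + _)%R]addrC subrK.
exact: concave_gradient_le.
Qed.

End gradient.
End gaussian_mean.

(** First-order condition at a maximum when only a supergradient, continuous along lines, is at
    hand. *)
Lemma sign_mul_le0_eq0 (R : realType) (phi : R -> R) :
  {for 0, continuous phi} -> (forall s, s * phi s <= 0) -> phi 0 = 0.
Proof.
move=> cphi sphi; apply/eqP; rewrite eq_le; apply/andP; split; rewrite leNgt;
  apply/negP => phi0.
- have /nbhs_ballP[e /= e0 eP] : \forall s \near (0 : R), 0 < phi s.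
    exact: (cvgr_gt _ cphi).
  have p : 0 < phi (e / 2).
    by apply: eP; rewrite /ball/= sub0r normrN gtr0_norm ?divr_gt0//; lra.
  by have := sphi (e / 2); rewrite leNgt mulr_gt0 ?divr_gt0// p.
- have /nbhs_ballP[e /= e0 eP] : \forall s \near (0 : R), phi s < 0.
    exact: (cvgr_lt _ cphi).
  have p : phi (- (e / 2)) < 0.
    by apply: eP; rewrite /ball/= sub0r opprK gtr0_norm ?divr_gt0//; lra.
  by have := sphi (- (e / 2)); rewrite leNgt nmulr_rgt0 ?oppr_lt0 ?divr_gt0// p.
Qed.

Lemma cvg_sumr (R : realType) (I : Type) (r : seq I) (T : Type)
    (F : set_system T) (f : I -> T -> R) (a : I -> R) : Filter F ->
  (forall i, f i x @[x --> F] --> a i) ->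
  \sum_(i <- r) f i x @[x --> F] --> \sum_(i <- r) a i.
Proof. by move=> FF fa; apply: cvg_big => //; exact: add_continuous. Qed.

Lemma continuous_sqnorm2 (R : realType) (n : nat) :
  continuous (@sqnorm2 R n).
Proof.
move=> x; rewrite /sqnorm2.
apply: (@cvg_sumr _ _ _ _ (nbhs x) _ _ (nbhs_filter x)) => i.
by rewrite expr2; apply: cvgM; exact: coord_continuous.
Qed.

(** * The fixed point *)

Section supergradient.
Context (R : realType) (n : nat) (t : R).
Variables (F : 'rV[R]_n -> R) (G : 'I_n -> 'rV[R]_n -> R).
Hypothesis t0 : 0 < t.
Hypothesis FG : forall y y', F y' <= F y + \sum_(i < n) (y' - y) ord0 i * G i y.
Hypothesis G_bounded : forall i r,
  exists B : R, forall y, sqnorm2 y <= r -> `|G i y| <= B.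
Hypothesis G_line : forall i y v,
  {for 0, continuous (fun s : R => G i (y + s *: v))}.

(** The inequality from [b] to [y] bounds [F y] above, the one from [y] to [b] bounds it below; the
    local bound on [G] makes both errors tend to zero. *)
Lemma supergradient_continuous : continuous F.
Proof.
move=> b.
have /choice[B Bb] i := G_bounded i (sqnorm2 b + 1).
have near_b : \forall y \near b, sqnorm2 y <= sqnorm2 b + 1.
  by apply: (cvgr_le _ (@continuous_sqnorm2 R n b)); lra.
pose D (y : 'rV[R]_n) := \sum_(i < n) `|y ord0 i - b ord0 i| * B i.
have D0 : D y @[y --> b] --> (0 : R).
  have -> : 0 = \sum_(i < n) `|b ord0 i - b ord0 i| * B i.
    by rewrite big1// => i _; rewrite subrr normr0 mul0r.
  apply: (@cvg_sumr _ _ _ _ (nbhs b) _ _ (nbhs_filter b)) => i.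
  apply: cvgMl; apply: cvg_norm.
  by apply: cvgB; [exact: coord_continuous|exact: cvg_cst].
have bb : sqnorm2 b <= sqnorm2 b + 1 by lra.
have FD : \forall y \near b, F b - D y <= F y <= F b + D y.
  apply: filterS near_b => y yb; apply/andP; split.
  - rewrite lerBlDr; apply: le_trans (FG y b) _; rewrite lerD2l.
    apply: ler_sum => i _; apply: le_trans (ler_norm _) _; rewrite normrM.
    by rewrite !mxE distrC ler_wpM2l// Bb.
  - apply: le_trans (FG b y) _; rewrite lerD2l.
    apply: ler_sum => i _; apply: le_trans (ler_norm _) _; rewrite normrM.
    by rewrite !mxE ler_wpM2l// Bb.
apply: (squeeze_cvgr FD).
- by rewrite -[X in _ --> X]subr0; apply: cvgB => //; exact: cvg_cst.
- by rewrite -[X in _ --> X]addr0; apply: cvgD => //; exact: cvg_cst.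
Qed.

Let J y := F y - sqnorm2 y / (2 * t).

(** Coercivity of [J]: half of the quadratic term absorbs the linear growth of [F], the other half
    remains. *)
Let J_le y : J y <= F 0 + t * (\sum_(i < n) G i 0 ^+ 2) - sqnorm2 y / (4 * t).
Proof.
have Fy : F y <= F 0 + (t * (\sum_(i < n) G i 0 ^+ 2) + sqnorm2 y / (4 * t)).
  apply: le_trans (FG 0 y) _; rewrite lerD2l subr0 /sqnorm2 mulr_suml mulr_sumr.
  rewrite -big_split/=; apply: ler_sum => i _.
  have -> : t * G i 0 ^+ 2 + y ord0 i ^+ 2 / (4 * t) =
      (y ord0 i - 2 * t * G i 0) ^+ 2 / (4 * t) + y ord0 i * G i 0.
    by field; rewrite gt_eqF.
  by rewrite lerDr divr_ge0 ?sqr_ge0// mulr_ge0// ltW.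
have -> : sqnorm2 y / (4 * t) = sqnorm2 y / (2 * t) - sqnorm2 y / (4 * t).
  by field; rewrite gt_eqF.
rewrite /J; lra.
Qed.

Let J_max : exists c, forall y, J y <= J c.
Proof.
pose S := \sum_(i < n) G i 0 ^+ 2.
have S0 : 0 <= S by apply: sumr_ge0 => i _; exact: sqr_ge0.
(* Outside the cube, [sqnorm2 y >= r ^+ 2 >= r >= 4 * t ^+ 2 * S], so [J_le] gives [J y <= J 0]. The
   summand 1 ensures [r <= r ^+ 2]. *)
pose r := 1 + 4 * t ^+ 2 * S.
have r1 : 1 <= r by rewrite lerDl mulr_ge0// mulr_ge0// sqr_ge0.
pose A := [set y : 'rV[R]_n | forall i, `[-r, r]%classic (y ord0 i)].
have A0 : A 0 by move=> i; rewrite /= in_itv/= mxE; lra.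
have cA : compact A.
  by apply: (@rV_compact _ _ (fun=> `[-r, r]%classic)) => i; exact: segment_compact.
have cJ : continuous J.
  move=> y; apply: (cvgB (@supergradient_continuous y)).
  by apply: cvgMl; exact: continuous_sqnorm2.
have [c _ cmax] := EVT_max_rV (ex_intro _ _ A0) cA (continuous_subspaceT cJ).
exists c => y; have [yA|/existsNP[i yi]] := pselect (A y).
  by apply: cmax; rewrite inE.
apply: (@le_trans _ _ (J 0)); last by apply: cmax; rewrite inE.
apply: le_trans (J_le y) _.
have -> : J 0 = F 0.
  by rewrite /J /sqnorm2 big1 ?mul0r ?subr0// => j _; rewrite mxE expr0n.
rewrite -addrA gerDl subr_le0 ler_pdivlMr ?mulr_gt0//.
have r2 : r <= r ^+ 2 by rewrite expr2 ler_peMr// (le_trans _ r1).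
have yr : r ^+ 2 <= y ord0 i ^+ 2.
  rewrite -[leRHS]real_normK ?num_real// lerXn2r ?nnegrE//; first lra.
  rewrite leNgt; apply/negP => yir; apply: yi.
  by move: yir; rewrite /= in_itv/= ltr_norml => /andP[? ?]; rewrite !ltW.
have yS : y ord0 i ^+ 2 <= sqnorm2 y.
  rewrite /sqnorm2 (bigD1 i)//= lerDl; apply: sumr_ge0 => j _; exact: sqr_ge0.
apply: le_trans yS; apply: le_trans yr; apply: le_trans r2; rewrite /r /S; lra.
Qed.

Lemma supergradient_fixpoint :
  exists y, unique (fun y : 'rV[R]_n => forall i, y ord0 i = t * G i y) y.
Proof.
(* The fixed points are the maximizers of the strictly concave [J]. *)
have [c cmax] := J_max; exists c.
suff cG i : c ord0 i = t * G i c.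
  split=> // y yG; apply/matrixP => k i; rewrite (ord1 k).
  (* The two supergradient inequalities between [c] and [y] add up to monotonicity of [G]: the inner
     product of [G y - G c] with [y - c] is at most 0. At fixed points it equals [|y - c|^2 / t]. *)
  have dS : \sum_(j < n) (y ord0 j - c ord0 j) ^+ 2 <= 0.
    have := FG c y; have := FG y c.
    set S1 := \sum_(j < n) _; set S2 := \sum_(j < n) _ => h1 h2.
    have -> : \sum_(j < n) (y ord0 j - c ord0 j) ^+ 2 = - (t * (S1 + S2)).
      rewrite /S1 /S2 -big_split/= mulr_sumr -sumrN; apply: eq_bigr => j _.
      by rewrite !mxE [in LHS]expr2 {1}yG {1}cG; ring.
    by rewrite oppr_le0 pmulr_rge0//; lra.
  have dS0 : \sum_(j < n) (y ord0 j - c ord0 j) ^+ 2 = 0.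
    by apply/eqP; rewrite eq_le dS sumr_ge0// => j _; exact: sqr_ge0.
  have /(_ i isT)/eqP := psumr_eq0P (fun j _ => sqr_ge0 _) dS0.
  by rewrite sqrf_eq0 subr_eq0 => /eqP.
pose e : 'rV[R]_n := delta_mx ord0 i.
(* The supergradient at the perturbed point gives [s * G i (c + s *: e) <= F (c + s *: e) - F c],
   and maximality of [c] bounds this by the increment of the quadratic term; hence
   [s * phi s <= 0]. *)
pose phi s := G i (c + s *: e) - (2 * c ord0 i + s) / (2 * t).
suff : phi 0 = 0.
  rewrite /phi scale0r !addr0 => /eqP; rewrite subr_eq0 => /eqP ->.
  by field; rewrite gt_eqF.
apply: sign_mul_le0_eq0 => [|s].
  apply: cvgB; first exact: G_line.
  by apply: cvgMl; apply: cvgD; [exact: cvg_cst|exact: cvg_id].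
have := cmax (c + s *: e); rewrite /J.
have -> : sqnorm2 (c + s *: e) = sqnorm2 c + (2 * s * c ord0 i + s ^+ 2).
  rewrite /sqnorm2 (bigD1 i)//= [in RHS](bigD1 i)//= !mxE !eqxx mulr1.
  rewrite (eq_bigr (fun j => c ord0 j ^+ 2)) => [|j /negPf ji]; first ring.
  by rewrite !mxE ji andbF mulr0 addr0.
have := FG (c + s *: e) c.
rewrite (bigD1 i)//= big1 => [|j /negPf ji]; last first.
  by rewrite !mxE ji andbF mulr0 addr0 subrr mul0r.
have -> : (c - (c + s *: e)) ord0 i = - s.
  by rewrite !mxE !eqxx mulr1; ring.
have -> : s * phi s = s * G i (c + s *: e) - (2 * s * c ord0 i + s ^+ 2) / (2 * t).
  by rewrite /phi; ring.
rewrite mulrDl; lra.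
Qed.
End supergradient.

(** * Relative entropy and the main bound *)

Section relative_entropy_density.
Local Open Scope ereal_scope.
Local Open Scope charge_scope.

Lemma measurable_lne d (T : measurableType d) (R : realType) (f : T -> \bar R) :
  measurable_fun setT f -> (forall x, f x \is a fin_num) ->
  measurable_fun setT (fun x => lne (f x)).
Proof.
move=> mf ff; rewrite (_ : (fun x => _) = (fun x =>
  if (0 < fine (f x))%R then (ln (fine (f x)))%:E else -oo)); last first.
  apply/funext => x; rewrite -[in LHS](fineK (ff x))/=.
  by rewrite leNgt; case: (0 < _)%R.
have mr : measurable_fun setT (fun x => fine (f x)).
  by apply: measurableT_comp => //; exact: fine_measurable.
apply: measurable_fun_ifT => //=.
  by apply: measurable_fun_ltr => //; exact: measurable_cst.
by apply/measurable_EFinP; exact: (measurableT_comp (@measurable_ln R)).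
Qed.

(** The Radon-Nikodym derivative agrees almost everywhere with [expR l], so the entropy integrand
    becomes [expR l * l], that is, [l] integrated against [Q]. *)
Lemma relative_entropy_density d (T : measurableType d) (R : realType)
    (Q P : probability T R) (l : T -> R) : measurable_fun setT l ->
  (forall A, measurable A -> Q A = \int[P]_(x in A) (expR (l x))%:E) ->
  relative_entropy Q P = \int[Q]_x (l x)%:E.
Proof.
move=> ml QE.
have mp : measurable_fun setT (fun x => expR (l x)) by exact: measurableT_comp.
have mpE : measurable_fun setT (fun x => (expR (l x))%:E).
  by apply/measurable_EFinP.
have mlE : measurable_fun setT (fun x => (l x)%:E) by apply/measurable_EFinP.
have QP : Q `<< P.
  apply/null_content_dominatesP => A mA PA.
  rewrite QE//.
  by apply: null_set_integral => //; exact: measurable_funS mpE.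
have QP' : charge_of_finite_measure Q `<< P := QP.
rewrite /relative_entropy asboolT//.
rewrite (integral_density mp (fun x => expR_ge0 (l x)) QE)//.
have rnE : ae_eq P setT ('d (charge_of_finite_measure Q) '/d P)
    (fun x => (expR (l x))%:E).
  apply: integral_ae_eq => //; first exact: Radon_Nikodym_integrable.
  move=> A _ mA.
  have <- := QE A mA.
  by rewrite -(Radon_Nikodym_integral QP' mA).
apply: ae_eq_integral => //.
- apply: emeasurable_funM => //.
  apply: measurable_lne => // x.
  exact: (Radon_Nikodym_fin_num x QP').
- exact: emeasurable_funM.
- apply: filterS rnE => x /(_ I) -> _.
  by rewrite lne_EFin ?expR_gt0// expRK muleC.
Qed.

(** Kept as the integral of the log-density, the form in which it combines with the integral of [f]
    into that of [f - l]. *)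
Lemma relative_entropy_gaussian (R : realType) n (y : 'rV[R]_n) t : (0 < t)%R ->
  relative_entropy (gaussian y t) (gaussian 0 t) =
  \int[gaussian y t]_x (dotrV x y / t - sqnorm2 y / (2 * t))%:E.
Proof.
move=> t0; apply: relative_entropy_density => [|A mA].
  apply: measurable_funB => //; apply: measurable_funM => //.
  exact: measurable_dotrV.
have m1 : measurable_fun setT (fun x : 'rV[R]_n => (\1_A x : R)%:E).
  by apply/measurable_EFinP; exact: measurable_indic.
have -> : gaussian y t A = \int[gaussian y t]_x (\1_A x : R)%:E.
  by rewrite integral_indic// setIT.
rewrite ge0_integral_gaussian_density// [RHS]integral_mkcond.
apply: eq_integral => x _; rewrite patchE indicE.
by case: ifPn => _; rewrite ?mul1e ?mul0e.
Qed.
End relative_entropy_density.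

Lemma lt_sume_pinfty (R : realDomainType) (I : finType) (a : I -> \bar R) :
  (forall i, 0 <= a i)%E -> (\sum_i a i < +oo)%E -> forall i, (a i < +oo)%E.
Proof.
move=> a0 aoo i; apply: le_lt_trans aoo; rewrite (bigD1 i)//=.
by rewrite leeDl//; apply: sume_ge0 => j _; exact: a0.
Qed.

Section gaussian_bound.
Context (R : realType) (n : nat) (t c : R) (f : 'rV[R]_n -> R).
Hypothesis t0 : 0 < t.
Hypothesis f_C2 : Ck 2 f.
Hypothesis f_concave : concave_function f.
Hypotheses (c0 : 0 <= c) (ct : c < 1 / (2 * t)).
Hypothesis fg : exp_growth c f.
Local Open Scope ereal_scope.

Let cf : continuous f. Proof. exact: (f_C2.1). Qed.
Let df i x : derivable f x (delta_mx ord0 i).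
Proof. exact: (f_C2.2 i).1. Qed.
Let cdf i : continuous (partial i f). Proof. exact: (f_C2.2 i).2.1. Qed.
Let ddf i j x : derivable (partial i f) x (delta_mx ord0 j).
Proof. exact: ((f_C2.2 i).2.2 j).1. Qed.
Let cddf i j : continuous (partial j (partial i f)).
Proof. exact: ((f_C2.2 i).2.2 j).2. Qed.

Let c' := ((c + 1 / (2 * t)) / 2)%R.
Let cc' : (c < c')%R. Proof. by rewrite /c' midf_lt. Qed.
Let c't : (c' < 1 / (2 * t))%R. Proof. by rewrite /c' midf_lt. Qed.
Let c'0 : (0 <= c')%R. Proof. exact: le_trans (ltW cc'). Qed.
Let dfg i : exp_growth c' (partial i f). Proof. exact: exp_growth_partial fg. Qed.

(** Half of the critical rate serves for both [l] and [f - l], since an affine function, or a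
    concave one from above, is dominated by any positive multiple of the squared norm plus a
    constant. *)
Let invt4 : (1 / (4 * t) < 1 / (2 * t))%R.
Proof.
by rewrite !div1r ltf_pV2 ?posrE ?mulr_gt0// ltr_pM2r//; lra.
Qed.

Lemma gaussian_partial_mean_fixpoint :
  exists y, unique (fun y : 'rV[R]_n => forall i : 'I_n, (y ord0 i)%:E =
    t%:E * \int[gaussian y t]_x (partial i f x)%:E) y.
Proof.
have gE (y : 'rV[R]_n) i : t%:E * \int[gaussian y t]_x (partial i f x)%:E =
    (t * gaussian_mean t (partial i f) y)%:E.
  by rewrite (gaussian_meanE t0 (@cdf i) c't (dfg i)) EFinM.
have [] := @supergradient_fixpoint R n t (gaussian_mean t f)
    (fun i => gaussian_mean t (partial i f)) t0.
- by move=> y y'; exact: gaussian_mean_gradient_le fg _ _ _ _ _.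
- move=> i r; exact: (gaussian_mean_bounded t0 (@cdf i) c'0 c't (dfg i) r).
- move=> i y v; exact: (gaussian_mean_continuous_line t0 (@cdf i) c'0 c't (dfg i)).
move=> y [yG yu]; exists y; split => [i|y' y'G].
  by rewrite gE -yG.
by apply: yu => i; have := y'G i; rewrite gE => -[].
Qed.

Variable y : 'rV[R]_n.
Let l (x : 'rV[R]_n) : R := (dotrV x y / t - sqnorm2 y / (2 * t))%R.

Let ml : measurable_fun setT l.
Proof.
apply: measurable_funB => //; apply: measurable_funM => //.
exact: measurable_dotrV.
Qed.

Let cl : continuous l.
Proof.
have cd : continuous (fun x : 'rV[R]_n => (dotrV x y / t)%R).
  have cd0 : continuous (fun x : 'rV[R]_n => dotrV x y).
    move=> x; rewrite /dotrV.
    apply: (@cvg_sumr _ _ _ _ (nbhs x) _ _ (nbhs_filter x)) => i.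
    by apply: cvgMl; exact: coord_continuous.
  by move=> x; apply: (cvgM (cd0 x)); exact: cvg_cst.
by move=> x; apply: (cvgB (cd x)); exact: cvg_cst.
Qed.

Let il : (gaussian y t).-integrable setT (EFin \o l).
Proof.
apply: exp_growth_integrable t0 invt4 cl _.
have S0 := sqnorm2_ge0 y.
have ti : (0 <= t^-1)%R by rewrite invr_ge0 ltW.
(* Cauchy's inequality gives [|l x| <= |x|^2 / (2 t) + |y|^2 / t]. The constant dominates this after
   multiplication by [1 + |x|^2 / (4 t)], which is at most the exponential. *)
exists (2 + sqnorm2 y / t)%R; first by rewrite addr_ge0// divr_ge0// ltW.
move=> x; have T0 := sqnorm2_ge0 x.
have dxy : (`|dotrV x y| <= sqnorm2 x / 2 + sqnorm2 y / 2)%R.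
  apply: le_trans (ler_norm_sum _ _ _) _; rewrite /sqnorm2 !mulr_suml -big_split/=.
  apply: ler_sum => i _; rewrite normrM.
  rewrite -(real_normK (num_real (x ord0 i))) -(real_normK (num_real (y ord0 i))).
  move: `|x _ _|%R `|y _ _|%R => a b; have := sqr_ge0 (a - b)%R; nra.
apply: (@le_trans _ _ ((2 + sqnorm2 y / t) * (1 + 1 / (4 * t) * sqnorm2 x))%R).
  apply: (@le_trans _ _ ((sqnorm2 x / 2 + sqnorm2 y / 2) / t + sqnorm2 y / (2 * t))%R).
    apply: le_trans (ler_normB _ _) _; rewrite lerD//.
      by rewrite normrM [(`|t^-1|)%R]ger0_norm// ler_wpM2r.
    by rewrite ger0_norm// divr_ge0// mulr_ge0// ltW.
  rewrite -subr_ge0.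
  have -> : ((2 + sqnorm2 y / t) * (1 + 1 / (4 * t) * sqnorm2 x) -
     ((sqnorm2 x / 2 + sqnorm2 y / 2) / t + sqnorm2 y / (2 * t)) =
     2 + sqnorm2 y * sqnorm2 x / (4 * t ^+ 2))%R.
    by field; rewrite gt_eqF.
  by rewrite addr_ge0// divr_ge0// mulr_ge0// sqr_ge0.
rewrite ler_wpM2l ?expR_ge1Dx//.
by rewrite addr_ge0// divr_ge0// ltW.
Qed.

Lemma relative_entropy_gaussian_fin_num :
  relative_entropy (gaussian y t) (gaussian 0 t) \is a fin_num.
Proof. by rewrite relative_entropy_gaussian//; exact: integrable_fin_num. Qed.

Let dg i (x : 'rV[R]_n) : R := (partial i f x - y ord0 i / t)%R.

Let cdg i : continuous (dg i).
Proof. by move=> x; apply: (cvgB (@cdf i x)); exact: cvg_cst. Qed.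

Let idf i : (gaussian y t).-integrable setT (EFin \o partial i f).
Proof. exact: exp_growth_integrable (dfg i). Qed.

Let if_ : (gaussian y t).-integrable setT (EFin \o f).
Proof. exact: exp_growth_integrable fg. Qed.

Let msq i : measurable_fun setT (fun x => (dg i x ^+ 2)%:E).
Proof.
apply/measurable_EFinP; apply: measurable_funX.
exact: (continuous_measurable_rV (@cdg i)).
Qed.

Hypothesis yE : forall i, (y ord0 i)%:E =
  t%:E * \int[gaussian y t]_x (partial i f x)%:E.

Let dg_sqr_le i : \int[gaussian y t]_x (dg i x ^+ 2)%:E <=
  t%:E * \sum_(j < n) \int[gaussian y t]_x (partial j (partial i f) x ^+ 2)%:E.
Proof.
have icst := finite_measure_integrable_cst (gaussian y t) (y ord0 i / t)
  measurableT.
have idg : (gaussian y t).-integrable setT (EFin \o dg i).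
  exact: (integrableB measurableT (idf i) icst).
have dg0 : \int[gaussian y t]_x (dg i x)%:E = 0.
  apply: etrans (integralB measurableT (idf i) icst) _ => /=.
  rewrite (integral_cst_probability (gaussian y t) (y ord0 i / t)%:E).
  have := yE i; rewrite -(fineK (integrable_fin_num measurableT (idf i))).
  rewrite -EFinM => -[->]; rewrite mulrAC divff ?gt_eqF// mul1r.
  by rewrite subee.
have h1 := mean0_sqr_le idg dg0.
have h2 : \int[gaussian y t]_x \int[gaussian y t]_x' ((dg i x - dg i x') ^+ 2)%:E <=
   (2 * t)%:E * \sum_(j < n) \int[gaussian y t]_x (partial j (partial i f) x ^+ 2)%:E.
  apply: (gaussian_poincare y t0 (@cdg i) (@cddf i)) => j x.
  have h : is_derive x (delta_mx ord0 j) (partial i f)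
      (partial j (partial i f) x) := DeriveDef (@ddf i j x) erefl.
  by apply: (is_derive_eq (is_deriveB h (is_derive_cst _ _ _))); rewrite subr0.
have := le_trans h1 h2.
by rewrite EFinM -muleA lee_pmul2l.
Qed.

Let row i := \sum_(j < n)
  \int[gaussian y t]_x (partial j (partial i f) x ^+ 2)%:E.

Let row_ge0 i : 0 <= row i.
Proof.
apply: sume_ge0 => j _.
by apply: integral_ge0 => x _; rewrite lee_fin sqr_ge0.
Qed.

Let gradient_le x z : (f z - l z <= f x - l x +
  \sum_(i < n) (z - x)%R ord0 i * dg i x)%R.
Proof.
have := concave_gradient_le f_concave df x (z - x)%R; rewrite addrC subrK => fz.
apply: le_trans (lerD fz (lexx _)) _.
have -> : l z = (l x + \sum_(i < n) (z - x)%R ord0 i * (y ord0 i / t))%R.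
  rewrite /l /dotrV !mulr_suml addrAC -big_split/=; congr (_ - _)%R.
  by apply: eq_bigr => i _; rewrite !mxE; ring.
rewrite opprD addrACA lerD2l -sumrB le_eqVlt; apply/predU1P; left.
by apply: eq_bigr => i _; rewrite mulrBr.
Qed.

(** Young's inequality in each coordinate, with the weight dictated by the cost; it is sharp at
    [z = x + t grad (f - l) (x)]. *)
Let gradient_ineq x z : (f z - l z <= f x - l x +
  t / 2 * (\sum_(i < n) dg i x ^+ 2) + sqnorm2 (x - z) / (2 * t))%R.
Proof.
apply: le_trans (gradient_le x z) _; rewrite -[leRHS]addrA lerD2l.
rewrite mulr_sumr /sqnorm2 mulr_suml -big_split/=; apply: ler_sum => i _.
rewrite !mxE; move: (dg i x) (x ord0 i) (z ord0 i) => d p q.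
rewrite -subr_ge0.
have -> : (t / 2 * d ^+ 2 + (p - q) ^+ 2 / (2 * t) - (q - p) * d =
   (q - p - t * d) ^+ 2 / (2 * t))%R by field; rewrite gt_eqF.
by rewrite divr_ge0 ?sqr_ge0// mulr_ge0// ltW.
Qed.

Let exponent_le x : (f x - l x <= (f 0 - l 0 +
  t * (\sum_(i < n) dg i 0 ^+ 2)) + 1 / (4 * t) * sqnorm2 x)%R.
Proof.
apply: le_trans (gradient_le 0 x) _; rewrite -[leRHS]addrA lerD2l.
rewrite /sqnorm2 !mulr_sumr -big_split/=; apply: ler_sum => i _.
rewrite subr0; move: (dg i 0) (x ord0 i) => d p; rewrite -subr_ge0.
have -> : (t * d ^+ 2 + 1 / (4 * t) * p ^+ 2 - p * d =
   (p - 2 * t * d) ^+ 2 / (4 * t))%R by field; rewrite gt_eqF.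
by rewrite divr_ge0 ?sqr_ge0// mulr_ge0// ltW.
Qed.

(** Finiteness of the sum makes the squared gradient of [f - l] integrable through [dg_sqr_le],
    hence also the function [h] of the transport inequality. *)
Lemma gaussian_lne_integral_expR_le : \sum_(i < n) row i < +oo ->
  lne (\int[gaussian 0 t]_x (expR (f x))%:E) <=
  \int[gaussian y t]_x (f x)%:E - relative_entropy (gaussian y t) (gaussian 0 t) +
  (t ^+ 2 / 2)%:E * \sum_(i < n) row i.
Proof.
move=> sum_fin.
have sq0 i : 0 <= \int[gaussian y t]_x (dg i x ^+ 2)%:E.
  by apply: integral_ge0 => x _; rewrite lee_fin sqr_ge0.
have row_fin := lt_sume_pinfty row_ge0 sum_fin.
have isq i : (gaussian y t).-integrable setT (fun x => (dg i x ^+ 2)%:E).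
  apply/integrableP; split => //.
  under eq_integral => x _ do rewrite gee0_abs ?lee_fin ?sqr_ge0//.
  apply: le_lt_trans (dg_sqr_le i) _.
  by apply: lte_mul_pinfty; [rewrite lee_fin ltW| |exact: row_fin].
have igl : (gaussian y t).-integrable setT ((EFin \o f) \- (EFin \o l)).
  exact: integrableB.
have iS := integrableZl measurableT (t / 2)
  (integrable_sum (P := xpredT) measurableT (index_enum 'I_n) (fun i _ => isq i)).
pose h x := ((EFin \o f) \- (EFin \o l)) x + (t / 2)%:E * \sum_(i < n) (dg i x ^+ 2)%:E.
have ih : (gaussian y t).-integrable setT h by exact: integrableD.
have cfl : continuous (fun x => f x - l x)%R.
  by move=> x; exact: (cvgB (@cf x) (@cl x)).
have invt0 : (0 <= 1 / (4 * t))%R by rewrite divr_ge0// mulr_ge0// ltW.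
have := gaussian_dual_talagrand t0 invt0 invt4 cfl exponent_le ih.
have hle x z : (f z - l z)%:E <= h x + (sqnorm2 (x - z) / (2 * t))%:E.
  by rewrite /h/= sumEFin -!EFinD lee_fin; exact: gradient_ineq.
move=> /(_ hle).
(* The density of [gaussian y t] with respect to [gaussian 0 t] is [expR l], which cancels
   [expR (- l)]. *)
have -> : \int[gaussian y t]_x (expR (f x - l x))%:E =
    \int[gaussian 0 t]_x (expR (f x))%:E.
  rewrite ge0_integral_gaussian_density//; last first.
    apply/measurable_EFinP; apply: measurableT_comp => //.
    exact: (continuous_measurable_rV cfl).
  by apply: eq_integral => x _; rewrite -EFinM -expRD subrK.
move=> expf_le.
have lnef_le : lne (\int[gaussian 0 t]_x (expR (f x))%:E) <= \int[gaussian y t]_x h x.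
  rewrite -[leRHS]fineK; last exact: integrable_fin_num.
  rewrite -[leRHS]expeRK lee_lne//=; rewrite in_itv/= leey andbT.
    by apply: integral_ge0 => x _; rewrite lee_fin expR_ge0.
  by rewrite lee_fin expR_ge0.
apply: le_trans lnef_le _.
rewrite integralD// integralB// relative_entropy_gaussian//.
rewrite leeD2l// integralZl//; last exact: integrable_sum.
rewrite integral_sum//.
have -> : (t ^+ 2 / 2)%:E * \sum_(i < n) row i =
    (t / 2)%:E * (t%:E * \sum_(i < n) row i).
  by rewrite muleA -EFinM; congr (_%:E * _); ring.
rewrite lee_wpmul2l//; first by rewrite lee_fin divr_ge0// ltW.
rewrite ge0_sume_distrr; last by move=> i _; exact: row_ge0.
by apply: lee_sum => i _; exact: dg_sqr_le.
Qed.

End gaussian_bound.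

Theorem proposition1p6 (R : realType) (n : nat) (t : R) (f : 'rV[R]_n -> R)
    (t_gt0 : 0 < t)
    (f_C2 : Ck 2 f)
    (f_concave : concave_function f)
    (f_growth : exists c1 c2 : R, [/\ 0 <= c1, 0 <= c2, c2 < 1 / (2 * t) &
      forall x : 'rV[R]_n, `|f x| <= c1 * expR (c2 * sqnorm2 x)]) :
  exists ystar : 'rV[R]_n,
    unique (fun y : 'rV[R]_n => forall i : 'I_n,
      (y ord0 i)%:E =
      (t%:E * \int[gaussian y t]_x (partial i f x)%:E)%E) ystar /\
    (lne (\int[gaussian 0 t]_x (expR (f x))%:E) <=
     ereal_sup (range (fun y : 'rV[R]_n =>
       \int[gaussian y t]_x (f x)%:E -
       relative_entropy (gaussian y t) (gaussian 0 t))) +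
     (t ^+ 2 / 2)%:E *
     \sum_(i < n) \sum_(j < n)
       \int[gaussian ystar t]_x (`|partial i (partial j f) x| ^+ 2)%:E)%E.
Proof.
have [c1 [c [c10 c0 ct f_le]]] := f_growth.
have fg : exp_growth c f by exists c1.
have [y [yE yu]] := gaussian_partial_mean_fixpoint t_gt0 f_C2 f_concave c0 ct fg.
exists y; split; first by split.
set V := fun z : 'rV[R]_n => (\int[gaussian z t]_x (f x)%:E -
  relative_entropy (gaussian z t) (gaussian 0 t))%E.
have Vy : (V y <= ereal_sup (range V))%E by apply: ereal_sup_ubound; exists y.
(* Exchanging the sums brings the indices into the order [partial j (partial i f)] of the bound. *)
rewrite exchange_big/=.
under eq_bigr => i _ do under eq_bigr => j _ do
  under eq_integral => x _ do rewrite real_normK ?num_real//.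
set S := (\sum_(i < n) _)%E.
have [Soo|Soo] := ltP S +oo%E.
  apply: le_trans (leeD2r _ Vy).
  exact: (gaussian_lne_integral_expR_le t_gt0 f_C2 f_concave c0 ct fg yE Soo).
have -> : S = +oo%E by apply/eqP; rewrite -leye_eq.
(* The error term is [+oo], but [-oo + +oo] is [-oo] by convention, so the supremum must be shown
   different from [-oo]; the finite value [V y] does this. *)
rewrite gt0_muley ?lte_fin ?divr_gt0 ?exprn_gt0//.
rewrite addey ?leey// gt_eqF//; apply: lt_le_trans Vy; rewrite ltNye_eq.
have fy := exp_growth_integrable y t_gt0 ct f_C2.1 fg.
by rewrite fin_numB (integrable_fin_num measurableT fy)/=
  relative_entropy_gaussian_fin_num.
Qed.
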